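(* Let $\mathbb{X}$ be the multivariate Graph supOU process with true parameter $\xi_0\in\mathfrak{W}$, and let $$\hat\xi_0^{N,m}=\arg\min_{\xi\in\mathfrak{W}}\,g_{N,m}(\mathbb{X},\xi)^T\,V_{N,m}\,g_{N,m}(\mathbb{X},\xi)$$ be the GMM estimator with positive definite weight matrices $V_{N,m}$. Assume: (1) $E(f(\mathbb{X}_t^{(m)},\xi))$ exists and is finite for all $\xi\in\mathfrak{W}$; and, with $g_t^{(m)}(\xi)=E(f(\mathbb{X}_t^{(m)},\xi))$, one has $g_t^{(m)}(\xi)=0$ for all $t$ if and only if $\xi=\xi_0$; (2) every component of $g_{N,m}(\mathbb{X},\xi)-E(f(\mathbb{X}_t^{(m)},\xi))$ converges to zero in probability as $N\to\infty$, uniformly in $\xi\in\mathfrak{W}$; (3) there is a deterministic sequence of positive definite matrices $\bar V_{N,m}$ such that $V_{N,m}-\bar V_{N,m}\to0$ in probability as $N\to\infty$. Then the estimator is weakly consistent: $\hat\xi_0^{N,m}\to\xi_0$ in probability as $N\to\infty$.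
   Context: $M_d^-$ is the set of real $d\times d$ matrices all of whose eigenvalues have strictly negative real part. $\Lambda$ is an $\mathbb{R}^d$-valued Lévy basis on $M_d^-\times\mathbb{R}$ with generating quadruple $(\gamma,\Sigma,\nu,\pi)$: $E\exp(iu^*\Lambda(B))=\exp(\phi(u)\Pi(B))$ with $\Pi=\pi\times\mathrm{Lebesgue}$ and $\phi(u)=iu^*\gamma-\frac12u^*\Sigma u+\int(e^{iu^*x}-1-iu^*x\mathbf 1_{[0,1]}(\|x\|))\nu(dx)$. $\mathbf{A}$ is the symmetric $0/1$ adjacency matrix (zero diagonal) of a fixed undirected graph on $d$ vertices, $\bar{\mathbf{A}}=\mathrm{diag}(n_1^{-1},\dots,n_d^{-1})\mathbf{A}$, $n_i=1\vee\sum_{j\ne i}a_{ij}$, $c$ is fixed with $|c|<1$, $K=-\mathbf{I}_{d\times d}-c\bar{\mathbf{A}}$, and $\pi$ is the law of $\mathbf{Q}=\theta_2K$ with $\theta_2\sim\Gamma(\alpha,\beta)$ (shape $\alpha>1$, rate $\beta>0$). The Graph supOU process is $\mathbb{X}_t=\int_{M_d^-}\int_{-\infty}^te^{\mathbf{Q}(t-s)}\Lambda(d\mathbf{Q},ds)$, assumed well defined with finite second moments. With $\mu_L=\gamma+\int_{\|x\|>1}x\,\nu(dx)$, $\sigma_L^2=\Sigma+\int_{\mathbb{R}^d}xx^*\nu(dx)$, $\mathcal{A}(K)X=KX+XK^*$, the moments as functions of the parameter vector $\xi$ (comprising the moment parameters of the underlying Lévy process and the parameters of $\pi$; $\xi\in\mathfrak{W}$,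 the parameter space) are $E_\xi(\mathbb{X}_0)=-\frac{\beta}{\alpha-1}K^{-1}\mu_L$ and $\mathrm{cov}_\xi(\mathbb{X}_h,\mathbb{X}_0)=-\frac{\beta^\alpha}{\alpha-1}(\beta\mathbf{I}_{d\times d}-Kh)^{1-\alpha}\mathcal{A}(K)^{-1}\sigma_L^2$. Observe $\mathbb{X}$ at times $\Delta,2\Delta,\dots,N\Delta$; abbreviate $\mathbb{X}_t$ for the observation at time $t\Delta$ and $\mathrm{cov}_\xi(\mathbb{X}_k,\mathbb{X}_0)$ for the covariance at lag $k$ observations; $\mathbb{X}_t^{(m)}=(\mathbb{X}_t,\dots,\mathbb{X}_{t+m})$, $m\ge2$. $f(\mathbb{X}_t^{(m)},\xi)\in\mathbb{R}^{d+(m+1)d(d+1)/2}$ stacks $\mathrm{vec}(\mathbb{X}_t-E_\xi(\mathbb{X}_0))$ and, for $k=0,\dots,m$, $\mathrm{vec}_h(\mathbb{X}_t\mathbb{X}_{t+k}^T-\mathrm{cov}_\xi(\mathbb{X}_k,\mathbb{X}_0)-E_\xi(\mathbb{X}_0)E_\xi(\mathbb{X}_0)^T)$, where $\mathrm{vec}_h$ stacks the entries of one triangle (including the diagonal). $g_{N,m}(\mathbb{X},\xi)=\frac1{N-m}\sum_{t=1}^{N-m}f(\mathbb{X}_t^{(m)},\xi)$. Expectations and probabilities are under the true law (parameter $\xi_0$).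
   Formalization: In (3) the formal statement also requires the positive definite matrices V̄_{N,m} to be bounded and uniformly positive definite in N (eigenvalues between fixed 0 < lo and hi); without this the claim fails, e.g. when V̄_{N,m} degenerates quickly as N → ∞. *)

(* Defs.v *)
From HB Require Import structures.
From mathcomp Require Import all_boot all_order all_algebra.
From mathcomp Require Import all_classical all_reals all_analysis.
From mathcomp Require Import complex.

Set Implicit Arguments.
Unset Strict Implicit.
Unset Printing Implicit Defensive.

Import Order.TTheory GRing.Theory Num.Theory.
Import numFieldNormedType.Exports.

Local Open Scope classical_set_scope.
Local Open Scope ring_scope.

Definition dot (R : realType) d (u v : 'cV[R]_d) : R := (u^T *m v) 0 0.

(* Euclidean norm (Frobenius norm on matrices). The truncation of small jumps
   and the value of gamma depend on this choice; the sup norm that the library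
   puts on matrices is not used. *)
Definition enorm (R : realType) p q (M : 'M[R]_(p, q)) : R :=
  Num.sqrt (\sum_i \sum_j M i j ^+ 2).

Definition possemidefmx (R : realType) d (V : 'M[R]_d) : Prop :=
  V^T = V /\ forall u : 'cV[R]_d, 0 <= dot u (V *m u).

Definition posdefmx (R : realType) d (V : 'M[R]_d) : Prop :=
  V^T = V /\ forall u : 'cV[R]_d, u != 0 -> 0 < dot u (V *m u).

Definition mexp (R : realType) d (A : 'M[R]_d) : 'M[R]_d :=
  \matrix_(i, j) limn (fun n => (\sum_(k < n) (k`!%:R)^-1 *: A ^+ k) i j).

(* Real power A^p of a real-diagonalizable matrix with positive eigenvalues:
   W diag(l) W^-1 |-> W diag(l^p) W^-1, whatever diagonalization is chosen.
   The value 0 for all other matrices is a placeholder. *)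
Definition mx_rpow (R : realType) d (A : 'M[R]_d) (p : R) : 'M[R]_d :=
  xget 0 [set B | exists (W : 'M[R]_d) (l : 'rV[R]_d),
    [/\ W \in unitmx, forall i, 0 < l 0 i,
        A = W *m diag_mx l *m invmx W &
        B = W *m diag_mx (\row_i (l 0 i `^ p)) *m invmx W]].

Definition lyap (R : realType) d (K X : 'M[R]_d) : 'M[R]_d :=
  K *m X + X *m K^T.

(* inverse of the linear operator [lyap K] on d x d matrices *)
Definition lyap_inv (R : realType) d (K S : 'M[R]_d) : 'M[R]_d :=
  vec_mx (mxvec S *m invmx (lin_mx (lyap K))).

Definition adjmx (R : realType) d (e : rel 'I_d) : 'M[R]_d :=
  \matrix_(i, j) (e i j)%:R.

Definition deg1 (R : realType) d (e : rel 'I_d) (i : 'I_d) : R :=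
  Num.max 1 (\sum_(j < d | j != i) adjmx R e i j).

Definition adjmx_bar (R : realType) d (e : rel 'I_d) : 'M[R]_d :=
  diag_mx (\row_i (deg1 R e i)^-1) *m adjmx R e.

Definition Kmx (R : realType) d (e : rel 'I_d) (c : R) : 'M[R]_d :=
  - 1%:M - c *: adjmx_bar R e.

(* Borel sigma-algebra of the space of p x q matrices, generated by the
   coordinates. *)
Definition mxcyl (R : realType) p q : set (set 'M[R]_(p, q)) :=
  [set A | exists i j (B : set R),
    measurable B /\ A = [set M : 'M[R]_(p, q) | B (M i j)]].

Definition mxb (R : realType) p q := g_sigma_algebraType (@mxcyl R p q).

Definition rmx_measurable (R : realType) (disp : measure_display)
    (T : measurableType disp) p q (Y : T -> 'M[R]_(p, q)) : Prop :=
  forall i j, measurable_fun [set: T] (fun w => Y w i j).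

Definition Emx (R : realType) (disp : measure_display)
    (Omega : measurableType disp) (P : probability Omega R) p q
    (Y : Omega -> 'M[R]_(p, q)) : 'M[R]_(p, q) :=
  \matrix_(i, j) (\int[P]_w (Y w i j)).

Definition cvg_prob (R : realType) (disp : measure_display)
    (Omega : measurableType disp) (P : probability Omega R) p q
    (Y : nat -> Omega -> 'M[R]_(p, q)) (Z : Omega -> 'M[R]_(p, q)) : Prop :=
  forall eps : R, 0 < eps ->
    P [set w | eps <= enorm (Y n w - Z w)] @[n --> \oo] --> 0%E.

Definition cexp (R : realType) (z : R[i]) : R[i] :=
  ((expR (complex.Re z) * cos (complex.Im z))
    +i* (expR (complex.Re z) * sin (complex.Im z)))%C.

Definition cintegral (R : realType) (disp : measure_display)
    (T : measurableType disp) (mu : {measure set T -> \bar R})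
    (f : T -> R[i]) : R[i] :=
  ((\int[mu]_x complex.Re (f x)) +i* (\int[mu]_x complex.Im (f x)))%C.

(* exp(i <u, x>) *)
Definition cis (R : realType) d (u x : 'cV[R]_d) : R[i] :=
  cexp (0 +i* dot u x)%C.

Definition levy_measure (R : realType) d
    (nu : {measure set (mxb R d 1) -> \bar R}) : Prop :=
  nu [set (0 : 'cV[R]_d)] = 0%E /\
  (\int[nu]_x (Num.min 1 (enorm (x : 'cV[R]_d) ^+ 2))%:E < +oo)%E.

Definition levy_exponent (R : realType) d (gamma : 'cV[R]_d)
    (Sigma : 'M[R]_d) (nu : {measure set (mxb R d 1) -> \bar R})
    (u : 'cV[R]_d) : R[i] :=
  ((- (2^-1 * dot u (Sigma *m u))) +i* dot u gamma)%C
  + cintegral nu (fun x : 'cV[R]_d =>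
      (cis u x - 1 - (0 +i* (if enorm x <= 1 then dot u x else 0)))%C).

Definition Mminus (R : realType) d : set 'M[R]_d :=
  [set A | forall z : R[i],
     eigenvalue (map_mx (real_complex R) A) z -> complex.Re z < 0].

(* Matrices times time; M_d^- x R is the subset [Mminus] of the first factor. *)
Definition QS (R : realType) d := (mxb R d d * measurableTypeR R)%type.

Definition bounded_borel (R : realType) d (B : set (QS R d)) : Prop :=
  [/\ measurable B,
      forall x, B x -> Mminus (x.1 : 'M[R]_d) &
      exists r : R, forall x, B x ->
        enorm (x.1 : 'M[R]_d) <= r /\ `|x.2 : R| <= r].

(* R^d-valued Levy basis on M_d^- x R with characteristic triplet
   (gamma, Sigma, nu) and control measure Pi. Infinite divisibility of L(B)
   is part of the form of the characteristic function. *)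
Record levy_basis (R : realType) (disp : measure_display)
    (Omega : measurableType disp) (P : probability Omega R) d
    (gamma : 'cV[R]_d) (Sigma : 'M[R]_d)
    (nu : {measure set (mxb R d 1) -> \bar R})
    (Pi : {measure set (QS R d) -> \bar R})
    (L : set (QS R d) -> Omega -> 'cV[R]_d) : Prop := {
  lb_measurable : forall B, bounded_borel B -> rmx_measurable (L B) ;
  lb_char : forall B, bounded_borel B -> forall u : 'cV[R]_d,
    cintegral P (fun w => cis u (L B w)) =
    cexp (levy_exponent gamma Sigma nu u * (fine (Pi B))%:C%C) ;
  lb_indep : forall (n : nat) (B : 'I_n -> set (QS R d)),
    (forall i, bounded_borel (B i)) -> trivIset [set: 'I_n] B ->
    forall E : 'I_n -> set (mxb R d 1), (forall i, measurable (E i)) ->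
    P (\bigcap_i (L (B i) @^-1` E i)) = (\prod_(i < n) P (L (B i) @^-1` E i))%E ;
  lb_sigma_additive : forall B : nat -> set (QS R d),
    (forall n, bounded_borel (B n)) -> trivIset [set: nat] B ->
    bounded_borel (\bigcup_n B n) ->
    {ae P, forall w, forall i : 'I_d,
      \sum_(k < n) L (B k) w i 0 @[n --> \oo] --> L (\bigcup_n B n) w i 0}
}.

(* Matrix-valued simple functions sum_k a_k 1_{B_k} on M_d^- x R. *)
Record simplefun (R : realType) d := SimpleFun {
  sf_num : nat ;
  sf_coef : 'I_sf_num -> 'M[R]_d ;
  sf_set : 'I_sf_num -> set (QS R d) ;
  sf_bounded : forall k, bounded_borel (sf_set k) ;
  sf_disjoint : trivIset [set: 'I_sf_num] sf_set
}.

Definition sf_eval (R : realType) d (s : simplefun R d) (x : QS R d) : 'M[R]_d :=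
  \sum_(k < sf_num s) (\1_(sf_set k) x : R) *: sf_coef k.

Definition sf_int (R : realType) T d (L : set (QS R d) -> T -> 'cV[R]_d)
    (s : simplefun R d) (A : set (QS R d)) (w : T) : 'cV[R]_d :=
  \sum_(k < sf_num s) sf_coef k *m L (A `&` sf_set k) w.

(* Rajput-Rosinski integral: f is L-integrable, and Z is (a version of) its
   integral over the whole space, as a limit in probability. *)
Definition levy_integral (R : realType) (disp : measure_display)
    (Omega : measurableType disp) (P : probability Omega R) d
    (Pi : {measure set (QS R d) -> \bar R})
    (L : set (QS R d) -> Omega -> 'cV[R]_d)
    (f : QS R d -> 'M[R]_d) (Z : Omega -> 'cV[R]_d) : Prop :=
  rmx_measurable f /\
  exists s : nat -> simplefun R d,
    [/\ {ae Pi, forall x, forall i j,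
           sf_eval (s n) x i j @[n --> \oo] --> f x i j},
        (forall A : set (QS R d), measurable A ->
           exists2 Y : Omega -> 'cV[R]_d, rmx_measurable Y &
             cvg_prob P (fun n => sf_int L (s n) A) Y),
        rmx_measurable Z &
        cvg_prob P (fun n => sf_int L (s n) setT) Z].

Definition gamma_fun (R : realType) (a : R) : R :=
  \int[lebesgue_measure]_(x in `]0, +oo[) (x `^ (a - 1) * expR (- x)).

Definition gamma_pdf (R : realType) (a b x : R) : R :=
  if 0 < x then b `^ a / gamma_fun a * x `^ (a - 1) * expR (- (b * x)) else 0.

(* Gamma distribution with shape a and rate b *)
Definition gamma_law (R : realType) (a b : R)
    (B : set (measurableTypeR R)) : \bar R :=
  (\int[lebesgue_measure]_(x in B) (gamma_pdf a b x)%:E)%E.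

(* kernel (Q, s) |-> e^{Q (t - s)} 1_{s <= t} *)
Definition supou_kernel (R : realType) d (t : R) (x : QS R d) : 'M[R]_d :=
  if (x.2 : R) <= t then mexp ((t - x.2) *: (x.1 : 'M[R]_d)) else 0.

(* X is the Graph supOU process of the graph e driven by some Levy basis with
   generating quadruple (gamma, Sigma, nu, pi), pi being the law of theta K
   with theta ~ Gamma(alpha, beta). *)
Definition graph_supOU (R : realType) (disp : measure_display)
    (Omega : measurableType disp) (P : probability Omega R) d
    (e : rel 'I_d) (c : R) (gamma : 'cV[R]_d) (Sigma : 'M[R]_d)
    (nu : {measure set (mxb R d 1) -> \bar R}) (alpha beta : R)
    (X : R -> Omega -> 'cV[R]_d) : Prop :=
  exists (piQ : probability (mxb R d d) R)
         (L : set (QS R d) -> Omega -> 'cV[R]_d),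
    let Pi : {measure set (QS R d) -> \bar R} :=
      (piQ \x (@lebesgue_measure R))%E in
    [/\ (forall B : set (mxb R d d), measurable B ->
           piQ B = pushforward (gamma_law alpha beta)
                     (fun theta : measurableTypeR R =>
                        ((theta : R) *: Kmx e c : mxb R d d)) B),
        levy_basis P gamma Sigma nu Pi L &
        forall t, levy_integral P Pi L (supou_kernel t) (X t)].

(* xi = (mu_L, sigma_L^2, alpha, beta) *)
Record gpar (R : realType) d := GPar {
  p_mu : 'cV[R]_d ;
  p_sigma2 : 'M[R]_d ;
  p_alpha : R ;
  p_beta : R
}.

(* admissible values; the parameter space is any subset of these *)
Definition gpar_dom (R : realType) d : set (gpar R d) :=
  [set xi | [/\ possemidefmx (p_sigma2 xi), 1 < p_alpha xi & 0 < p_beta xi]].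

Definition gpar_dist (R : realType) d (xi xi' : gpar R d) : R :=
  Num.sqrt (enorm (p_mu xi - p_mu xi') ^+ 2
            + enorm (p_sigma2 xi - p_sigma2 xi') ^+ 2
            + (p_alpha xi - p_alpha xi') ^+ 2 + (p_beta xi - p_beta xi') ^+ 2).

Definition gpar_measurable (R : realType) (disp : measure_display)
    (T : measurableType disp) d (Y : T -> gpar R d) : Prop :=
  [/\ rmx_measurable (fun w => p_mu (Y w)),
      rmx_measurable (fun w => p_sigma2 (Y w)),
      measurable_fun [set: T] (fun w => p_alpha (Y w)) &
      measurable_fun [set: T] (fun w => p_beta (Y w))].

Definition mu_L (R : realType) d (gamma : 'cV[R]_d)
    (nu : {measure set (mxb R d 1) -> \bar R}) : 'cV[R]_d :=
  \col_i (gamma i 0 +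
    \int[nu]_(x in [set x : mxb R d 1 | 1 < enorm (x : 'cV[R]_d)])
      (x : 'cV[R]_d) i 0).

Definition sigma2_L (R : realType) d (Sigma : 'M[R]_d)
    (nu : {measure set (mxb R d 1) -> \bar R}) : 'M[R]_d :=
  \matrix_(i, j) (Sigma i j +
    \int[nu]_x ((x : 'cV[R]_d) i 0 * (x : 'cV[R]_d) j 0)).

(* E_xi(X_0) *)
Definition mean_xi (R : realType) d (K : 'M[R]_d) (xi : gpar R d) : 'cV[R]_d :=
  - (p_beta xi / (p_alpha xi - 1)) *: (invmx K *m p_mu xi).

(* cov_xi(X_h, X_0) *)
Definition cov_xi (R : realType) d (K : 'M[R]_d) (h : R) (xi : gpar R d)
    : 'M[R]_d :=
  - (p_beta xi `^ p_alpha xi / (p_alpha xi - 1)) *: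
    (mx_rpow ((p_beta xi)%:M - h *: K) (1 - p_alpha xi)
       *m lyap_inv K (p_sigma2 xi)).

Definition lowtri d : {set 'I_d * 'I_d} := [set p : 'I_d * 'I_d | (p.2 <= p.1)%N].

(* half-vectorization: the entries (i, j), j <= i *)
Definition vech (R : realType) d (M : 'M[R]_d) : 'cV[R]_#|lowtri d| :=
  \col_k M (enum_val k).1 (enum_val k).2.

Definition gmm_dim d m : nat := (d + \sum_(k < m.+1) #|lowtri d|)%N.

Lemma gmm_dimE d m : gmm_dim d m = (d + m.+1 * (d * d.+1)./2)%N.
Proof.
rewrite /gmm_dim sum_nat_const card_ord; congr (_ + _ * _)%N.
have -> : #|lowtri d| = (\sum_(i < d) i.+1)%N.
  rewrite -sum1_card (eq_bigl (fun p : 'I_d * 'I_d => true && (p.2 <= p.1)%N)).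
    rewrite -(pair_big_dep xpredT (fun i j : 'I_d => (j <= i)%N) (fun _ _ => 1%N)).
    apply: eq_bigr => i _ /=; rewrite sum1_card.
    have winj : injective (widen_ord (ltn_ord i)).
      by move=> j k /(congr1 val) /= jk; apply: val_inj.
    rewrite -[RHS]card_ord -(card_imset _ winj).
    apply: eq_card => j; rewrite unfold_in; apply/idP/imsetP => [ji|[k _ ->]].
      by exists (Ordinal (ji : (j < i.+1)%N)) => //; apply: val_inj.
    by change (k <= i)%N; rewrite -ltnS ltn_ord.
  by move=> p; rewrite finset.in_set.
have -> : (\sum_(i < d) i.+1 = \sum_(0 <= i < d.+1) i)%N.
  by rewrite big_nat_recl // add0n big_mkord.
by rewrite bin2_sum bin2 mulnC.
Qed.

(* moment function at a window (x_t, ..., x_{t+m}) of observations with time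
   step Delta, so that lag k is the time difference k * Delta *)
Definition gmm_f (R : realType) d m (K : 'M[R]_d) (Delta : R)
    (x : 'I_m.+1 -> 'cV[R]_d) (xi : gpar R d) : 'cV[R]_(gmm_dim d m) :=
  col_mx (x ord0 - mean_xi K xi)
    (\mxcol_(k < m.+1)
       vech (x ord0 *m (x k)^T - cov_xi K (k%:R * Delta) xi
             - mean_xi K xi *m (mean_xi K xi)^T)).

(* (X_t, ..., X_{t+m}), observation t being made at time t * Delta *)
Definition obs_window (R : realType) T d m (Delta : R)
    (X : R -> T -> 'cV[R]_d) (t : nat) (w : T) : 'I_m.+1 -> 'cV[R]_d :=
  fun k => X ((t + k)%:R * Delta) w.

Definition gmm_g (R : realType) T d m (K : 'M[R]_d) (Delta : R)
    (X : R -> T -> 'cV[R]_d) (N : nat) (w : T) (xi : gpar R d)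
    : 'cV[R]_(gmm_dim d m) :=
  ((N - m)%:R)^-1 *:
    \sum_(1 <= t < (N - m).+1) gmm_f K Delta (obs_window Delta X t w) xi.
Arguments gmm_g {R T d} m K Delta X N w xi.

(* E f(X_t^(m), xi) *)
Definition gmm_Ef (R : realType) (disp : measure_display)
    (Omega : measurableType disp) (P : probability Omega R) d m
    (K : 'M[R]_d) (Delta : R) (X : R -> Omega -> 'cV[R]_d) (t : nat)
    (xi : gpar R d) : 'cV[R]_(gmm_dim d m) :=
  Emx P (fun w => gmm_f K Delta (obs_window Delta X t w) xi).
Arguments gmm_Ef {R disp Omega} P {d} m K Delta X t xi.

(* Main.v *)
Require Import Defs.
From mathcomp Require Import all_boot all_order all_algebra.
From mathcomp Require Import all_classical all_reals all_analysis.
From mathcomp Require Import complex measurable_realfun ring lra.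

Set Implicit Arguments.
Unset Strict Implicit.
Unset Printing Implicit Defensive.

Import Order.TTheory GRing.Theory Num.Theory.
Import numFieldNormedType.Exports.

Local Open Scope classical_set_scope.
Local Open Scope ring_scope.

(* The moment function splits as f(x, xi) = F(x) - M(xi), so that
   g_N(xi) = g_N(xi0) + M(xi0) - M(xi) and, by (1), E f(X_t, xi0) = 0 gives
   g_N(xi0) -> 0 in probability. Comparing the minimal value with the value at
   xi0, and using that V_N is close to the uniformly positive definite Vbar_N,
   M(xihat) -> M(xi0) in probability. As the parameter space need not be
   compact, it remains to show that M is injective with continuous inverse at
   xi0 on the whole natural parameter domain.

   Let sigma_L^2 <> 0. The matrix -K is similar to a symmetric one with positive
   eigenvalues lambda_j, and cov_h = f_h(-K) cov_0 with
   f_h(x) = (1 + h x / beta)^(1 - alpha). Only the lower triangle of cov_h is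
   observed; but if D is f_h(-K) at xi minus its value at xi0, smallness of the
   lower triangle of D cov_0 makes tr((D cov_0)^2) small, because every
   product of two opposite entries contains one from that triangle. The range
   of cov_0 is invariant under the symmetrized K by the Lyapunov equation, and
   this trace therefore controls (f_h(lambda_j; xi) - f_h(lambda_j; xi0))^2 for
   some fixed j. The lags h = Delta, 2 Delta finally determine (alpha, beta),
   since ln (1 + 2 x) / ln (1 + x) is strictly decreasing.

   If sigma_L^2 = 0, then X is almost surely constant, g_N(xi0) = 0 almost
   surely, and the estimator equals xi0 by (1). *)

(** * Real symmetric matrices *)

Lemma mul_trmx_self_ge0 (R : realDomainType) n (w : 'rV[R]_n) : 0 <= (w *m w^T) 0 0.
Proof. by rewrite mxE sumr_ge0 // => i _; rewrite mxE -expr2 sqr_ge0. Qed.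

Lemma mul_trmx_self_eq0 (R : realDomainType) n (w : 'rV[R]_n) :
  (w *m w^T) 0 0 = 0 -> w = 0.
Proof.
rewrite mxE => /psumr_eq0P w0; apply/rowP => i; apply/eqP.
rewrite mxE -sqrf_eq0 expr2; have := w0 _ i isT.
by rewrite mxE => -> // j _; rewrite mxE -expr2 sqr_ge0.
Qed.

(** The complexified matrix is Hermitian, so the complex spectral theorem gives it a real
    eigenvalue. Only the eigenvalue is carried back, through the characteristic polynomial; an
    eigenvector is then found over [R] and normalized. *)
Lemma sym_eigenvector (R : rcfType) n (A : 'M[R]_n.+1) : A^T = A ->
  exists (a : R) (v : 'rV[R]_n.+1), v *m A = a *: v /\ v *m v^T = 1%:M.
Proof.
move=> symA; pose AC : 'M[R[i]]_n.+1 := map_mx (real_complex R) A.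
have realA : AC \is a realmx.
  by apply/mxOverP => i j; rewrite mxE complex_real.
have symAC : AC \is symmetricmx.
  apply/is_hermitianmxP; rewrite expr0 scale1r; apply/matrixP => i j.
  by rewrite !mxE -[in LHS]symA mxE.
have hermA := realsym_hermsym symAC realA.
have /orthomx_spectralP AE := hermitian_normalmx hermA.
have /mxOverP/(_ 0 0) lreal := hermitian_spectral_diag_real hermA.
set P := spectralmx AC in AE; set l := spectral_diag AC in AE lreal.
have Pu : P \in unitmx := spectral_unit AC.
have evA : eigenvalue AC (l 0 0).
  apply/eigenvalueP; exists (row 0 P).
    rewrite AE -row_mul !mulmxA mulmxV // mul1mx.
    by rewrite row_mul row_diag_mx -scalemxAl -rowE.
  apply/negP => /eqP P0; have := mulmxV Pu.
  move=> /(congr1 (row 0)); rewrite row_mul P0 mul0mx => /rowP/(_ 0).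
  by rewrite !mxE eqxx => /esym/eqP; rewrite oner_eq0.
pose a := complex.Re (l 0 0).
have la : l 0 0 = (real_complex R) a.
  by apply/esym/RRe_real.
have {evA} : eigenvalue A a.
  by move: evA; rewrite !eigenvalue_root_char la -map_char_poly fmorph_root.
move=> /eigenvalueP [v vA v0]; pose q := (v *m v^T) 0 0.
have q0 : 0 < q.
  rewrite lt_neqAle mul_trmx_self_ge0 andbT.
  by apply: contraNneq v0 => /esym/mul_trmx_self_eq0 ->.
exists a, ((Num.sqrt q)^-1 *: v); split.
  by rewrite -scalemxAl vA !scalerA mulrC.
rewrite linearZ /= -scalemxAl -scalemxAr scalerA.
rewrite [v *m v^T]mx11_scalar -/q -scalemx1 scalerA -invfM -expr2 sqr_sqrtr ?ltW //.
by rewrite mulVf ?gt_eqF // scale1r.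
Qed.

(** Away from v = e, with e the first basis vector, [H] is the reflection in the hyperplane
    orthogonal to v - e, which exchanges the two unit vectors. *)
Lemma householder (R : rcfType) n (v : 'rV[R]_n.+1) : v *m v^T = 1%:M ->
  exists H : 'M[R]_n.+1, [/\ H^T = H, H *m H = 1%:M & row 0 H = v].
Proof.
move=> v1; pose e : 'rV[R]_n.+1 := delta_mx 0 0.
have [->|ve] := eqVneq v e.
  by exists 1%:M; rewrite trmx1 mulmx1 row1.
have [w wE] : exists w, w = v - e by exists (v - e).
pose q := (w *m w^T) 0 0.
have wwE : w *m w^T = q%:M by rewrite [LHS]mx11_scalar.
have ee : e *m e^T = 1%:M by rewrite /e trmx_delta mul_delta_mx [LHS]mx11_scalar mxE eqxx.
have ve0 : v *m e^T = (v 0 0)%:M.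
  by rewrite [LHS]mx11_scalar; congr (_%:M); rewrite /e trmx_delta -colE mxE.
have ev0 : e *m v^T = (v 0 0)%:M.
  by rewrite -[LHS]trmxK trmx_mul trmxK ve0 tr_scalar_mx.
have qE : q = 2 - 2 * v 0 0.
  rewrite /q wE linearB /= mulmxBl !mulmxBr v1 ee ve0 ev0 !mxE eqxx /= !mulr1n.
  ring.
have q0 : q != 0.
  by apply: contraNneq ve => /mul_trmx_self_eq0/eqP; rewrite wE subr_eq0.
exists (1%:M - (2 / q) *: (w^T *m w)); split.
- by rewrite linearB linearZ /= trmx1 trmx_mul trmxK.
- rewrite mulmxBl mul1mx mulmxBr mulmx1 -scalemxAl -scalemxAr scalerA.
  rewrite -mulmxA (mulmxA w) wwE mul_scalar_mx -scalemxAr scalerA.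
  have -> : 2 / q * (2 / q) * q = 2 / q + 2 / q by field.
  by rewrite scalerDl opprB addrK subrK.
- rewrite rowE mulmxBr mulmx1 -/e -scalemxAr mulmxA.
  have -> : e *m w^T = (v 0 0 - 1)%:M.
    by rewrite wE linearB /= mulmxBr ev0 ee -raddfB.
  rewrite mul_scalar_mx scalerA (_ : 2 / q * _ = -1).
    by rewrite scaleN1r opprK wE addrC subrK.
  have -> : v 0 0 - 1 = - (q / 2) by rewrite qE; field.
  by field.
Qed.

(** Induction by deflation: conjugation with a reflection whose first row is a unit eigenvector
    leaves only the eigenvalue in the first row, hence by symmetry in the first column, and the
    remaining block is symmetric. *)
Lemma sym_spectral (R : rcfType) n (A : 'M[R]_n) : A^T = A ->
  exists (Q : 'M[R]_n) (l : 'rV[R]_n), Q *m Q^T = 1%:M /\ A = Q^T *m diag_mx l *m Q.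
Proof.
elim: n A => [|n IH] A symA.
  exists 1%:M, 0; split; first by rewrite mul1mx trmx1.
  by apply/matrixP => -[].
have [a [v [vA v1]]] := sym_eigenvector symA.
have [H [HT HH Hv]] := householder v1.
pose e : 'rV[R]_n.+1 := delta_mx 0 0.
have eH : e *m H = v by rewrite -rowE.
have [A' A'H] : exists A' : 'M[R]_(1 + n), A' = H *m A *m H by exists (H *m A *m H).
have symA' : A'^T = A' by rewrite A'H !trmx_mul symA HT mulmxA.
have eA' : e *m A' = a *: e.
  by rewrite A'H !mulmxA eH vA -scalemxAl -eH -mulmxA HH mulmx1.
have A'0 j : A' 0 j = a *+ (j == 0).
  by move/rowP/(_ j): eA'; rewrite -rowE !mxE eqxx /= mulr_natr.
have A'l : A' (lshift n 0) (lshift n 0) = a.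
  by rewrite (_ : lshift n 0 = 0) ?A'0 ?eqxx //; apply/val_inj.
have A'r j : A' (lshift n 0) (rshift 1 j) = 0.
  by rewrite (_ : lshift n 0 = 0) ?A'0 //; apply/val_inj.
pose A1 : 'M[R]_n := drsubmx A'.
have A'E : A' = block_mx a%:M 0 0 A1.
  rewrite -[LHS]submxK; congr block_mx; apply/matrixP => i j; rewrite ?ord1.
  - by rewrite !mxE A'l eqxx.
  - by rewrite !mxE A'r.
  - by rewrite -symA' !mxE A'r.
have symA1 : A1^T = A1 by rewrite /A1 trmx_drsub symA'.
have [Q1 [l1 [Q1Q A1E]]] := IH _ symA1.
pose Q2 : 'M[R]_(1 + n) := block_mx 1%:M 0 0 Q1.
have Q2T : Q2^T = block_mx 1%:M 0 0 Q1^T by rewrite tr_block_mx !trmx0 trmx1.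
have Q2Q : Q2 *m Q2^T = 1%:M.
  rewrite Q2T mulmx_block !mulmx0 !mul0mx mulmx1 !addr0 add0r Q1Q.
  by rewrite -scalar_mx_block.
pose l : 'rV[R]_(1 + n) := row_mx a%:M l1.
have lD : diag_mx l = block_mx a%:M 0 0 (diag_mx l1).
  by rewrite diag_mx_row; congr block_mx; apply/matrixP => i j; rewrite !ord1 !mxE eqxx mulr1n.
have A'D : A' = Q2^T *m diag_mx l *m Q2.
  rewrite Q2T lD !mulmx_block !(mulmx0, mul0mx) !mulmx1 !mul1mx.
  by rewrite !addr0 !add0r -A1E A'E mul0mx.
exists (Q2 *m H), l; split.
  by rewrite trmx_mul HT mulmxA -(mulmxA Q2) HH mulmx1.
have -> : A = H *m A' *m H by rewrite A'H !mulmxA HH mul1mx -mulmxA HH mulmx1.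
by rewrite trmx_mul HT A'D !mulmxA.
Qed.

Lemma quad_delta (R : comPzRingType) n (A : 'M[R]_n) (i j : 'I_n) (s t : R) :
  let v : 'rV[R]_n := s *: delta_mx 0 i + t *: delta_mx 0 j in
  (v *m A *m v^T) 0 0
  = s ^+ 2 * A i i + s * t * (A i j + A j i) + t ^+ 2 * A j j.
Proof.
move=> v; have -> : v^T = s *: delta_mx i 0 + t *: delta_mx j 0.
  by rewrite linearD !linearZ /= !trmx_delta.
rewrite !mulmxDl !mulmxDr -!scalemxAl -!scalemxAr -!rowE -!colE !mxE; ring.
Qed.

(** If A_ii = 0, the form at s e_i + e_j is affine in s with slope 2 A_ij, so a nonzero slope would
    make it negative somewhere. *)
Lemma psd_diag0 (R : realFieldType) n (A : 'M[R]_n) : A^T = A ->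
  (forall v : 'rV[R]_n, 0 <= (v *m A *m v^T) 0 0) ->
  forall i j, A i i = 0 -> A i j = 0.
Proof.
move=> symA psdA i j Aii; apply/eqP/negPn/negP => Aij.
(* This multiple of e_i gives the form the value -1. *)
have := psdA (- (A j j + 1) / (2 * A i j) *: delta_mx 0 i + 1 *: delta_mx 0 j).
rewrite quad_delta Aii; have -> : A j i = A i j by rewrite -[in LHS]symA mxE.
have -> : - (A j j + 1) / (2 * A i j) * 1 * (A i j + A i j) = - (A j j + 1) by field.
lra.
Qed.

(* [c] and [j] depend on [lam] and [S] only. The condition on [del] says that
   [diag_mx del] is a function of [diag_mx lam]. *)
Lemma lyap_coercive (R : rcfType) n (lam : 'rV[R]_n) (S : 'M[R]_n) :
  (forall i, 0 < lam 0 i) -> S^T = S -> S != 0 ->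
  (forall v : 'rV[R]_n,
     0 <= (v *m (diag_mx lam *m S + S *m diag_mx lam) *m v^T) 0 0) ->
  exists j c, 0 < c /\ forall del : 'rV[R]_n,
    (forall i k, lam 0 i = lam 0 k -> del 0 i = del 0 k) ->
    c * del 0 j ^+ 2 <= \tr (diag_mx del *m S *m (diag_mx del *m S)).
Proof.
move=> lam0 symS S0 psd.
have [Q [s [QQ SE]]] := sym_spectral symS.
have QQ' : Q^T *m Q = 1%:M by apply: mulmx1C.
pose L := diag_mx lam.
(* [M] is [diag_mx lam] in the eigenbasis of [S]; there the Lyapunov expression has the entries M_ij
   (s_i + s_j). *)
have [M ME] : exists M, M = Q *m L *m Q^T by eexists.
have conjE (D : 'rV[R]_n) i j :
    (Q *m diag_mx D *m Q^T) i j = \sum_k Q i k * Q j k * D 0 k.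
  rewrite mxE; apply: eq_bigr => k _; rewrite mul_mx_diag !mxE; ring.
have conjC (D : 'rV[R]_n) i j :
    (Q *m diag_mx D *m Q^T) i j = (Q *m diag_mx D *m Q^T) j i.
  by rewrite !conjE; apply: eq_bigr => k _; ring.
have Q1 i : \sum_k Q i k ^+ 2 = 1.
  transitivity ((Q *m Q^T) i i); last by rewrite QQ mxE eqxx.
  by rewrite mxE; apply: eq_bigr => k _; rewrite mxE expr2.
have exQ i : exists k, Q i k != 0.
  have [k Qk|Q0] := pickP (fun k => Q i k != 0); first by exists k.
  have := Q1 i; rewrite big1 => [/esym/eqP|k _]; first by rewrite oner_eq0.
  by move/negbFE/eqP: (Q0 k) => ->; rewrite expr0n.
have MC i j : M i j = M j i by rewrite ME conjC.
have Mpos i : 0 < M i i.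
  rewrite ME conjE; have [k Qk] := exQ i.
  rewrite (bigD1 k) //= ltr_pwDl //; last first.
    by apply: sumr_ge0 => l _; rewrite mulr_ge0 ?(ltW (lam0 _)) // -expr2 sqr_ge0.
  by rewrite mulr_gt0 // -expr2 exprn_even_gt0.
pose A := M *m diag_mx s + diag_mx s *m M.
have AE : A = Q *m (L *m S + S *m L) *m Q^T.
  rewrite mulmxDr mulmxDl /A ME SE; congr (_ + _).
    by rewrite !mulmxA -[RHS]mulmxA QQ mulmx1.
  by rewrite !mulmxA QQ mul1mx.
have Aij i j : A i j = M i j * (s 0 i + s 0 j).
  rewrite /A mxE mul_mx_diag mul_diag_mx !mxE; ring.
have symA : A^T = A.
  by apply/matrixP => i j; rewrite mxE !Aij [M j i]MC addrC.
have psdA (v : 'rV[R]_n) : 0 <= (v *m A *m v^T) 0 0.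
  by have := psd (v *m Q); rewrite AE trmx_mul !mulmxA.
have s_ge0 i : 0 <= s 0 i.
  have := psdA (1 *: delta_mx 0 i + 0 *: delta_mx 0 i); rewrite quad_delta.
  rewrite expr1n expr0n mul1r mulr0 !mul0r !addr0 Aij pmulr_rge0 //; lra.
(* A zero eigenvalue s_i annihilates row i of the positive semidefinite [A], so [M] does not couple
   the kernel and the range of [S]. *)
have Ms i j : s 0 i = 0 -> s 0 j != 0 -> M i j = 0.
  move=> si sj; have Aii : A i i = 0 by rewrite Aij si addr0 mulr0.
  have /eqP := psd_diag0 symA psdA j Aii.
  by rewrite Aij si add0r mulf_eq0 (negbTE sj) orbF => /eqP.
(* [p] is the orthogonal projection on the range of [S] in the eigenbasis of
   [S]; it commutes with [L], hence with every function of [L]. *)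
pose p : 'rV[R]_n := \row_i (s 0 i != 0)%:R.
have pM : M *m diag_mx p = diag_mx p *m M.
  apply/matrixP => i j; rewrite mul_mx_diag mul_diag_mx !mxE.
  have [si|si] := eqVneq (s 0 i) 0; have [sj|sj] := eqVneq (s 0 j) 0;
    rewrite /= ?(mulr1, mul1r, mulr0, mul0r) //; first by rewrite Ms.
  by rewrite MC Ms.
have [Pi PiE] : exists Pi, Pi = Q^T *m diag_mx p *m Q by eexists.
have PiL : Pi *m L = L *m Pi.
  have -> : L = Q^T *m M *m Q by rewrite ME !mulmxA QQ' mul1mx -mulmxA QQ' mulmx1.
  rewrite PiE !mulmxA -[_ *m Q *m Q^T]mulmxA QQ mulmx1 -[_ *m Q *m Q^T]mulmxA QQ mulmx1.
  by rewrite -!mulmxA (mulmxA _ M) -pM !mulmxA.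
have [i0 si0] : exists i, s 0 i != 0.
  have [k sk|s0] := pickP (fun k => s 0 k != 0); first by exists k.
  case/eqP: S0; rewrite SE (_ : s = 0) ?linear0 ?mulmx0 ?mul0mx //.
  by apply/rowP => k; move/negbFE/eqP: (s0 k) => ->; rewrite mxE.
have [k0 Qk0] := exQ i0.
pose C := \sum_(i | s 0 i != 0) (s 0 i * s 0 i0)^-1.
have ss_gt0 i : s 0 i != 0 -> 0 < s 0 i * s 0 i0.
  by move=> si; rewrite mulr_gt0 // lt_neqAle eq_sym ?si ?si0 s_ge0.
have C0 : 0 < C.
  rewrite /C (bigD1 i0) //= ltr_pwDl ?invr_gt0 ?ss_gt0 //.
  by apply: sumr_ge0 => i /andP[si _]; rewrite invr_ge0 ltW ?ss_gt0.
(* Column i0 of N = Q diag(del) Q^T has squared norm sum_k Q_{i0 k}^2 del_k^2, which is at least its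
   k0 term. Each N_{i i0}^2 with s_i nonzero is at most the trace divided by s_i s_{i0}, and the
   other entries vanish; summation gives the constant. *)
exists k0, (Q i0 k0 ^+ 2 / C); split.
  by rewrite divr_gt0 // exprn_even_gt0.
move=> del lamdel; have [N NE] : exists N, N = Q *m diag_mx del *m Q^T by eexists.
have NC i j : N i j = N j i by rewrite NE conjC.
(* Commutation with [L] reads Pi_ij (lam_j - lam_i) = 0, so del_i = del_j wherever Pi_ij is
   nonzero. *)
have PiD : Pi *m diag_mx del = diag_mx del *m Pi.
  apply/matrixP => i j; rewrite mul_mx_diag mul_diag_mx !mxE [RHS]mulrC.
  move/matrixP/(_ i j): PiL; rewrite mul_mx_diag mul_diag_mx ![in LHS]mxE ![in RHS]mxE.
  rewrite [RHS]mulrC => /eqP; rewrite -subr_eq0 -mulrBr mulf_eq0 => /orP[/eqP ->|].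
    by rewrite !mul0r.
  by rewrite subr_eq0 => /eqP/lamdel ->.
have pN : diag_mx p *m N = N *m diag_mx p.
  have -> : diag_mx p = Q *m Pi *m Q^T by rewrite PiE !mulmxA QQ mul1mx -mulmxA QQ mulmx1.
  rewrite NE !mulmxA -[_ *m Q^T *m Q]mulmxA QQ' mulmx1 -[_ *m Q^T *m Q]mulmxA QQ' mulmx1.
  by rewrite -(mulmxA Q) PiD mulmxA.
have N0 i : s 0 i = 0 -> N i i0 = 0.
  move=> si; move/matrixP/(_ i i0): pN.
  by rewrite mul_mx_diag mul_diag_mx !mxE si si0 eqxx mul0r mulr1 => ->.
have trE : \tr (diag_mx del *m S *m (diag_mx del *m S))
    = \sum_i \sum_j N i j ^+ 2 * (s 0 i * s 0 j).
  rewrite SE !mulmxA mxtrace_mulC !mulmxA.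
  rewrite -NE -(mulmxA (N *m _)) -(mulmxA _ _ Q^T) -NE -(mulmxA (N *m _)).
  apply: eq_bigr => i _; rewrite mxE; apply: eq_bigr => j _.
  rewrite !mul_mx_diag !mxE [N j i]NC; ring.
rewrite trE mulrAC ler_pdivrMr //.
have bnd i : s 0 i != 0 -> N i i0 ^+ 2 <= (s 0 i * s 0 i0)^-1 *
    (\sum_i \sum_j N i j ^+ 2 * (s 0 i * s 0 j)).
  have tge i' j' : 0 <= N i' j' ^+ 2 * (s 0 i' * s 0 j').
    by rewrite mulr_ge0 ?sqr_ge0 ?mulr_ge0.
  move=> si; rewrite ler_pdivlMl ?ss_gt0 // mulrC (bigD1 i) //= (bigD1 i0) //=.
  rewrite -addrA lerDl addr_ge0 ?sumr_ge0 // => j _; exact: sumr_ge0.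
apply: (@le_trans _ _ (\sum_i N i i0 ^+ 2)).
  have -> : \sum_i N i i0 ^+ 2 = \sum_k Q i0 k ^+ 2 * del 0 k ^+ 2.
    transitivity ((N *m N) i0 i0).
      by rewrite mxE; apply: eq_bigr => i _; rewrite [N i0 i]NC expr2.
    rewrite NE !mulmxA -[_ *m Q^T *m Q]mulmxA QQ' mulmx1 mxE.
    apply: eq_bigr => k _; rewrite !mul_mx_diag !mxE; ring.
  rewrite (bigD1 k0) //= lerDl sumr_ge0 // => k _.
  by rewrite mulr_ge0 ?sqr_ge0.
rewrite (bigID (fun i => s 0 i == 0)) /= big1 ?add0r; last first.
  by move=> i /eqP/N0 ->; rewrite expr0n.
by rewrite mulrC mulr_suml ler_sum // => i; exact: bnd.
Qed.

(** * Two lags determine shape and rate *)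

(* With [t = ln (1 + y) / ln (1 + x) > 1] this is the strict convexity of
   [s |-> s ^ t] at the midpoint [1 + x] of [1] and [1 + 2 x]. *)
Lemma ln_ratio_decr (R : realType) (x y : R) : 0 < x -> x < y ->
  ln (1 + 2 * y) * ln (1 + x) < ln (1 + 2 * x) * ln (1 + y).
Proof.
move=> x0 xy; have y0 : 0 < y by apply: lt_trans xy.
have p0 : 0 < ln (1 + x) by apply: ln_gt0; lra.
have pq : ln (1 + x) < ln (1 + y) by rewrite ltr_ln ?posrE; lra.
have Ep : expR (ln (1 + x)) = 1 + x by rewrite lnK // posrE; lra.
have Eq : expR (ln (1 + 2 * x)) = 1 + 2 * x by rewrite lnK // posrE; lra.
have Ey : expR (ln (1 + y)) = 1 + y by rewrite lnK // posrE; lra.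
set p := ln (1 + x) in p0 pq Ep *; set q := ln (1 + 2 * x) in Eq *.
pose t := ln (1 + y) / p.
have t1 : 1 < t by rewrite ltr_pdivlMr // mul1r.
have yE : ln (1 + y) = t * p by rewrite /t divfK // gt_eqF.
rewrite yE mulrA ltr_pM2r // -ltr_expR lnK; last by rewrite posrE; lra.
have -> : y = expR (t * p) - 1 by rewrite -yE Ey; ring.
have bern a : expR a * (1 + (t - 1) * a) <= expR (t * a).
  have -> : t * a = a + (t - 1) * a by ring.
  by rewrite expRD ler_pM2l ?expR_gt0 // expR_ge1Dx.
have ba := bern (q - p); have bb := bern (- p).
have e1 : expR (q - p) * expR p = 1 + 2 * x by rewrite -expRD subrK.
have e2 : expR (- p) * expR p = 1 by rewrite -expRD addNr expR0.
have f1 : expR (t * (q - p)) * expR (t * p) = expR (q * t).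
  by rewrite -expRD; congr expR; ring.
have f2 : expR (t * - p) * expR (t * p) = 1.
  by rewrite -expRD mulrN addNr expR0.
(* The tangent bound a e^a >= e^a - 1 is taken at a = q - p and a = -p. It is strict at -p because p
   > 0, which makes the final inequality strict. *)
have g1 : expR (q - p) * (q - p) >= expR (q - p) - 1.
  have := expR_ge1Dx (- (q - p)); rewrite -(ler_pM2l (expR_gt0 (q - p))).
  rewrite -expRD subrr expR0; lra.
have g2 : expR (- p) * (- p) > expR (- p) - 1.
  have := @expR_gt1Dx R p; rewrite gt_eqF // => /(_ isT).
  rewrite -(ltr_pM2l (expR_gt0 (- p))) -expRD addNr expR0; lra.
(* The two exponentials are (1 + 2x)/(1 + x) and 1/(1 + x). *)
have sum2 : expR (q - p) + expR (- p) = 2.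
  have ep : expR p != 0 by rewrite gt_eqF ?expR_gt0.
  apply: (mulIf ep); rewrite mulrDl e1 e2 Ep; ring.
have key : 2 < expR (t * (q - p)) + expR (t * - p).
  apply: lt_le_trans (lerD ba bb); rewrite -subr_gt0.
  have -> : forall A B : R, A * (1 + (t - 1) * (q - p)) + B * (1 + (t - 1) * - p) - 2
    = (A + B - 2) + (t - 1) * (A * (q - p) + B * - p) by move=> *; ring.
  rewrite sum2 subrr add0r mulr_gt0 ?subr_gt0 //; lra.
move: key; rewrite -(ltr_pM2r (expR_gt0 (t * p))) [ltRHS]mulrDl f1 f2; lra.
Qed.

(** Logarithms turn the hypotheses into limits of a ln(1 + x) and a ln(1 + 2x). For fixed c > 0 the
    combination a (ln(1 + 2c) ln(1 + x) - ln(1 + 2x) ln(1 + c)) has the sign of x - c by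
    [ln_ratio_decr], so its limit decides on which side of c the values of x eventually lie. No a
    priori bound on x or a enters. *)
Lemma powR_pair_cvg (R : realType) (T : Type) (F : set_system T) {FF : Filter F}
    (x a : T -> R) (x0 a0 : R) : 0 < x0 -> 0 < a0 ->
  (\forall t \near F, 0 < x t /\ 0 < a t) ->
  (1 + x t) `^ (- a t) @[t --> F] --> (1 + x0) `^ (- a0) ->
  (1 + 2 * x t) `^ (- a t) @[t --> F] --> (1 + 2 * x0) `^ (- a0) ->
  x @ F --> x0 /\ a @ F --> a0.
Proof.
move=> x0_gt0 a0_gt0 pos c1 c2.
have lnc (c : R) : 0 < c ->
    (1 + c * x t) `^ (- a t) @[t --> F] --> (1 + c * x0) `^ (- a0) ->
    a t * ln (1 + c * x t) @[t --> F] --> a0 * ln (1 + c * x0).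
  move=> c0 h; rewrite -[_ * ln (1 + c * x0)]opprK -mulNr -ln_powR.
  have -> : (fun t => a t * ln (1 + c * x t)) =
            (fun t => - ln ((1 + c * x t) `^ (- a t))).
    by apply/funext => t; rewrite ln_powR mulNr opprK.
  apply: cvgN; apply: (continuous_cvg _ _ h); apply: continuous_ln.
  by rewrite powR_gt0 // ltr_wpDr // mulr_ge0 ?ltW.
have P1 : a t * ln (1 + x t) @[t --> F] --> a0 * ln (1 + x0).
  have := lnc 1 ltr01; rewrite mul1r => h.
  under eq_fun do rewrite -[x _]mul1r.
  by apply: h; under eq_fun do rewrite mul1r.
have P2 := lnc 2 (ltr0Sn _ _) c2.
have lim c : a t * (ln (1 + 2 * c) * ln (1 + x t) - ln (1 + 2 * x t) * ln (1 + c))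
    @[t --> F] --> a0 * (ln (1 + 2 * c) * ln (1 + x0) - ln (1 + 2 * x0) * ln (1 + c)).
  have -> : a0 * (ln (1 + 2 * c) * ln (1 + x0) - ln (1 + 2 * x0) * ln (1 + c)) =
     ln (1 + 2 * c) * (a0 * ln (1 + x0)) - (a0 * ln (1 + 2 * x0)) * ln (1 + c) by ring.
  have -> : (fun t => a t * (ln (1 + 2 * c) * ln (1 + x t) - ln (1 + 2 * x t) * ln (1 + c)))
      = (fun t => ln (1 + 2 * c) * (a t * ln (1 + x t)) - (a t * ln (1 + 2 * x t)) * ln (1 + c)).
    by apply/funext => t; ring.
  by apply: cvgB; apply: cvgM => //; exact: cvg_cst.
have lo c : 0 < c -> c < x0 -> \forall t \near F, c < x t.
  move=> c0 cx; have /cvgr_gt /(_ 0) := lim c.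
  rewrite pmulr_rgt0 // subr_gt0 ln_ratio_decr // => /(_ isT) h.
  near=> t; have [] : 0 < x t /\ 0 < a t by near: t.
  move=> xt at0; rewrite ltNge; apply/negP => xc.
  have : 0 < a t * (ln (1 + 2 * c) * ln (1 + x t) - ln (1 + 2 * x t) * ln (1 + c)).
    by near: t.
  rewrite pmulr_rgt0 // subr_gt0; move: xc; rewrite le_eqVlt => /orP[/eqP ->|xc].
    by rewrite ltxx.
  by rewrite ltNge ltW // ln_ratio_decr.
have hi c : x0 < c -> \forall t \near F, x t < c.
  move=> cx; have c0 : 0 < c by apply: lt_trans cx.
  have /cvgr_lt /(_ 0) := lim c.
  rewrite pmulr_rlt0 // subr_lt0 ln_ratio_decr // => /(_ isT) h.
  near=> t; have [] : 0 < x t /\ 0 < a t by near: t.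
  move=> xt at0; rewrite ltNge; apply/negP => xc.
  have : a t * (ln (1 + 2 * c) * ln (1 + x t) - ln (1 + 2 * x t) * ln (1 + c)) < 0.
    by near: t.
  rewrite pmulr_rlt0 // subr_lt0; move: xc; rewrite le_eqVlt => /orP[/eqP ->|xc].
    by rewrite ltxx.
  by rewrite ltNge ltW // ln_ratio_decr.
have cx : x @ F --> x0.
  apply/cvgrPdist_lt => e e0.
  (* The term x0 / 2 keeps the lower barrier positive, as [lo] demands, when e is large. *)
  have l : \forall t \near F, Num.max (x0 - e) (x0 / 2) < x t.
    apply: lo; first by rewrite lt_max orbC divr_gt0.
    by rewrite gt_max; apply/andP; split; lra.
  have h : \forall t \near F, x t < x0 + e by apply: hi; lra.
  near=> t; have : Num.max (x0 - e) (x0 / 2) < x t by near: t.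
  rewrite gt_max => /andP[l1 _]; have h1 : x t < x0 + e by near: t.
  by rewrite ltr_norml; apply/andP; split; lra.
split=> //.
have l0 : 0 < ln (1 + x0) by apply: ln_gt0; lra.
have cl : ln (1 + x t) @[t --> F] --> ln (1 + x0).
  apply: continuous_cvg; first by apply: continuous_ln; lra.
  by apply: cvgD => //; exact: cvg_cst.
have -> : a0 = a0 * ln (1 + x0) * (ln (1 + x0))^-1 by rewrite mulfK // gt_eqF.
apply: cvg_trans (cvgM P1 (cvgV _ cl)); last by rewrite gt_eqF.
apply: near_eq_cvg; near=> t; have [xt _] : 0 < x t /\ 0 < a t by near: t.
by rewrite /= mulfK // gt_eqF // ln_gt0 // ltrDl.
Unshelve. all: by end_near.
Qed.

(** * The drift matrix K and the Lyapunov operator *)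

Lemma deg1_ge1 (R : realType) d (e : rel 'I_d) i : 1 <= deg1 R e i.
Proof. by rewrite /deg1 le_max lexx. Qed.

Lemma deg1_gt0 (R : realType) d (e : rel 'I_d) i : 0 < deg1 R e i.
Proof. exact: lt_le_trans ltr01 (deg1_ge1 _ _ _). Qed.

Lemma sum_adjmx_le_deg1 (R : realType) d (e : rel 'I_d) i : irreflexive e ->
  \sum_j adjmx R e i j <= deg1 R e i.
Proof.
move=> irr; rewrite (bigD1 i) //= mxE irr add0r /deg1.
by rewrite (eq_bigl (fun j => j != i)) // le_max lexx orbT.
Qed.

Lemma KmxE (R : realType) d (e : rel 'I_d) (c : R) i j :
  Kmx e c i j = - ((i == j)%:R + c * ((deg1 R e i)^-1 * (e i j)%:R)).
Proof. rewrite /Kmx /adjmx_bar mul_diag_mx !mxE opprD. done. Qed.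

Lemma eigenvalue_KmxN_gt0 (R : realType) d (e : rel 'I_d) (c : R) (u : 'rV[R]_d) l :
  symmetric e -> irreflexive e -> `|c| < 1 ->
  u *m (- Kmx e c) = l *: u -> u != 0 -> 0 < l.
Proof.
move=> sym irr c1 ul u0; pose n := deg1 R e; pose y i := u 0 i / n i.
have n0 i : 0 < n i := deg1_gt0 R e i.
have [i0 ui0] : exists i, u 0 i != 0 by apply/rV0Pn.
have uE k : l * (n k * y k) = n k * y k + c * \sum_i adjmx R e k i * y i.
  have nyk : n k * y k = u 0 k by rewrite /y mulrC divfK // gt_eqF.
  rewrite nyk; have -> : l * u 0 k = (u *m (- Kmx e c)) 0 k by rewrite ul mxE.
  rewrite /Kmx opprD !opprK mulmxDr mulmx1 -scalemxAr mxE; congr (_ + _).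
  rewrite mxE; congr (_ * _); rewrite /adjmx_bar mulmxA mul_mx_diag mxE.
  apply: eq_bigr => i _; by rewrite !mxE sym [LHS]mulrC.
have [k ymax] : exists k, forall i, `|y i| <= `|y k|.
  case: (@arg_maxP _ _ _ i0 xpredT (fun i => `|y i|)) => // k _ h.
  by exists k => i; apply: h.
have yk0 : 0 < `|y k|.
  apply: lt_le_trans (ymax i0); rewrite normr_gt0 mulf_neq0 // invr_eq0 gt_eqF //.
have bnd : `|\sum_i adjmx R e k i * y i| <= n k * `|y k|.
  apply: le_trans (ler_norm_sum _ _ _) _.
  apply: le_trans (ler_wpM2r (normr_ge0 _) (sum_adjmx_le_deg1 R k irr)).
  rewrite mulr_suml ler_sum // => i _; rewrite normrM ler_pM //.
  by rewrite mxE; case: (e k i); rewrite ?normr1 ?normr0.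
have : `|(l - 1) * (n k * y k)| < n k * `|y k|.
  rewrite mulrBl mul1r uE addrC addKr normrM.
  apply: le_lt_trans (ler_wpM2l (normr_ge0 _) bnd) _.
  by rewrite gtr_pMl // mulr_gt0.
rewrite normrM [`|n k * _|]normrM (gtr0_norm (n0 k)) gtr_pMl ?mulr_gt0 //.
by rewrite ltr_norml => /andP[h _]; lra.
Qed.

(** With D the diagonal matrix of the [deg1], D^(1/2) (-K) D^(-1/2) is symmetric, and G = Q D^(1/2)
    for its orthogonal eigenbasis Q. That [G^T *m G] is diagonal lets [corr_cvg] pass between
    coordinates without mixing rows. *)
Lemma Kmx_diagonalize (R : realType) d (e : rel 'I_d) (c : R) :
  symmetric e -> irreflexive e -> `|c| < 1 ->
  exists (G : 'M[R]_d) (lam : 'rV[R]_d),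
    [/\ G \in unitmx, forall i, 0 < lam 0 i,
        Kmx e c = - (invmx G *m diag_mx lam *m G) &
        G^T *m G = diag_mx (\row_i deg1 R e i)].
Proof.
move=> sym irr c1.
pose r : 'rV[R]_d := \row_i Num.sqrt (deg1 R e i).
pose r' : 'rV[R]_d := \row_i (Num.sqrt (deg1 R e i))^-1.
have r_neq0 i : Num.sqrt (deg1 R e i) != 0 by rewrite gt_eqF // sqrtr_gt0 deg1_gt0.
have rr' : diag_mx r *m diag_mx r' = 1%:M.
  by apply/matrixP => i j; rewrite mulmx_diag !mxE divff.
have r'r := mulmx1C rr'.
have rr : diag_mx r *m diag_mx r = diag_mx (\row_i deg1 R e i).
  rewrite mulmx_diag; congr diag_mx; apply/rowP => i.
  by rewrite !mxE -expr2 sqr_sqrtr // ltW // deg1_gt0.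
pose B := diag_mx r *m (- Kmx e c) *m diag_mx r'.
have symB : B^T = B.
  apply/matrixP => i j; rewrite mxE /B.
  have rE k : (deg1 R e k)^-1 = (Num.sqrt (deg1 R e k))^-1 ^+ 2.
    by rewrite exprVn sqr_sqrtr // ltW // deg1_gt0.
  have BE a b : B a b = Num.sqrt (deg1 R e a) * (- Kmx e c a b) / Num.sqrt (deg1 R e b).
    by rewrite /B mul_mx_diag mul_diag_mx !mxE.
  rewrite !BE !KmxE !opprK; have [->//|ij] := eqVneq i j.
  rewrite !add0r sym (rE i) (rE j); field.
  by rewrite !r_neq0.
have [Q [l [QQ BE]]] := sym_spectral symB.
have QQ' := mulmx1C QQ.
pose G := Q *m diag_mx r.
have Gu : G \in unitmx.
  by rewrite unitmx_mul (mulmx1_unit QQ).1 (mulmx1_unit rr').1.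
have GK : G *m (- Kmx e c) = diag_mx l *m G.
  rewrite /G -mulmxA (_ : diag_mx r *m _ = B *m diag_mx r).
    by rewrite BE !mulmxA QQ mul1mx.
  by rewrite /B -mulmxA r'r mulmx1.
exists G, l; split => //.
- move=> i; apply: (@eigenvalue_KmxN_gt0 _ _ e c (row i G)) => //.
    by rewrite -row_mul GK row_mul row_diag_mx -scalemxAl -rowE.
  apply/eqP => Gi; have := mulmxV Gu.
  move=> /(congr1 (row i)); rewrite row_mul Gi mul0mx => /rowP/(_ i).
  by rewrite !mxE eqxx => /esym/eqP; rewrite oner_eq0.
- by rewrite -mulmxA -GK mulKmx // opprK.
- rewrite /G trmx_mul tr_diag_mx mulmxA -(mulmxA _ Q^T) QQ' mulmx1 rr //.
Qed.

(** The change of basis C between two diagonalizations satisfies C_ij (l'_j - l_i) = 0, so it also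
    intertwines the powers; the value chosen by [xget] is therefore independent of the
    diagonalization. *)
Lemma mx_rpow_diag (R : realType) d (W : 'M[R]_d) (l : 'rV[R]_d) (p : R) :
  W \in unitmx -> (forall i, 0 < l 0 i) ->
  mx_rpow (W *m diag_mx l *m invmx W) p
  = W *m diag_mx (\row_i (l 0 i `^ p)) *m invmx W.
Proof.
move=> Wu l0; rewrite /mx_rpow; case: xgetP => [B _|]; last first.
  by move=> /(_ (W *m diag_mx (\row_i (l 0 i `^ p)) *m invmx W))[]; exists W, l.
case=> W' [l' [W'u l'0 E ->]].
have [C CW] : exists C, C = invmx W *m W' by eexists.
have CE : C *m diag_mx l' = diag_mx l *m C.
  have -> : diag_mx l *m C = invmx W *m (W *m diag_mx l *m invmx W) *m W'.
    by rewrite CW !mulmxA mulVmx // mul1mx.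
  by rewrite E CW !mulmxA mulmxKV.
have CE' : C *m diag_mx (\row_i (l' 0 i `^ p)) = diag_mx (\row_i (l 0 i `^ p)) *m C.
  apply/matrixP => i j; move/matrixP/(_ i j): CE.
  rewrite !mul_mx_diag !mul_diag_mx !mxE => /eqP.
  rewrite [l 0 i * _]mulrC -subr_eq0 -mulrBr mulf_eq0 => /orP[/eqP ->|].
    by rewrite mul0r mulr0.
  by rewrite subr_eq0 => /eqP ->; rewrite mulrC.
rewrite (_ : W' = W *m C); last by rewrite CW mulKVmx.
have Cu : C \in unitmx by rewrite CW unitmx_mul unitmx_inv Wu.
have -> : invmx (W *m C) = invmx C *m invmx W.
  apply: (can_inj (mulKmx W'u)).
  rewrite {1}(_ : W' = W *m C); last by rewrite CW mulKVmx.
  rewrite mulmxV ?unitmx_mul ?Wu // {1}(_ : W' = W *m C); last by rewrite CW mulKVmx.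
  by rewrite mulmxA mulmxK // mulmxV.
by rewrite !mulmxA -(mulmxA W) CE' mulmxA mulmxK.
Qed.

(** In the coordinates Y = G X G^T the Lyapunov operator multiplies Y_ij by -(lam_i + lam_j), which
    makes it visibly injective for positive [lam]. *)
Lemma lyap_conj (R : realType) d (G : 'M[R]_d) (lam : 'rV[R]_d) (X : 'M[R]_d) :
  G \in unitmx ->
  G *m lyap (- (invmx G *m diag_mx lam *m G)) X *m G^T
  = - (diag_mx lam *m (G *m X *m G^T) + G *m X *m G^T *m diag_mx lam).
Proof.
move=> Gu; rewrite /lyap linearN /= !trmx_mul tr_diag_mx mulNmx mulmxN -opprD.
rewrite mulmxN mulNmx; congr (- _); rewrite mulmxDr mulmxDl !mulmxA mulmxV // mul1mx.
by rewrite trmx_inv mulmxKV // unitmx_tr.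
Qed.

Lemma lyap_inj (R : realType) d (G : 'M[R]_d) (lam : 'rV[R]_d) (X : 'M[R]_d) :
  G \in unitmx -> (forall i, 0 < lam 0 i) ->
  lyap (- (invmx G *m diag_mx lam *m G)) X = 0 -> X = 0.
Proof.
move=> Gu lam0 X0; have := lyap_conj lam X Gu; rewrite X0 mulmx0 mul0mx.
move=> /esym/eqP; rewrite oppr_eq0 => /eqP YE.
have Y0 : G *m X *m G^T = 0.
  move: (G *m X *m G^T) YE => Y /matrixP YE; apply/matrixP => i j; apply/eqP.
  move: (YE i j); rewrite mul_mx_diag mul_diag_mx !mxE => /eqP.
  by rewrite [Y i j * _]mulrC -mulrDl mulf_eq0 gt_eqF ?addr_gt0.
have GTu : G^T \in unitmx by rewrite unitmx_tr.
by rewrite -[X](mulKmx Gu) -[G *m X](mulmxK GTu) Y0 mul0mx mulmx0.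
Qed.

(** In finite dimension injectivity makes the matrix of the operator invertible, so that [invmx] is
    a genuine inverse. *)
Lemma lyap_invK (R : realType) d (K S : 'M[R]_d) :
  (forall X, lyap K X = 0 -> X = 0) -> lyap K (lyap_inv K S) = S.
Proof.
move=> injK; pose f : {linear 'M[R]_d -> 'M[R]_d} := mulmx K \+ mulmxr K^T.
have fE X : mxvec X *m lin_mx (lyap K) = mxvec (lyap K X) by apply: (mul_vec_lin f).
have u : lin_mx (lyap K) \in unitmx.
  rewrite -row_free_unit; apply: inj_row_free => v.
  rewrite -[v]vec_mxK fE => /eqP; rewrite mxvec_eq0 => /eqP/injK ->.
  by rewrite linear0.
apply: (can_inj mxvecK); rewrite -fE /lyap_inv vec_mxK mulmxKV //.
Qed.

(** The operator commutes with transposition, and solutions are unique. *)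
Lemma lyap_inv_sym (R : realType) d (K S : 'M[R]_d) :
  (forall X, lyap K X = 0 -> X = 0) -> S^T = S -> (lyap_inv K S)^T = lyap_inv K S.
Proof.
move=> injK symS; apply/eqP; rewrite -subr_eq0; apply/eqP/injK.
have trL (X : 'M[R]_d) : lyap K X^T = (lyap K X)^T.
  by rewrite /lyap linearD /= !trmx_mul trmxK addrC.
have -> : lyap K ((lyap_inv K S)^T - lyap_inv K S) =
  lyap K (lyap_inv K S)^T - lyap K (lyap_inv K S).
  by rewrite /lyap mulmxBr mulmxBl opprD addrACA.
by rewrite trL lyap_invK // symS subrr.
Qed.

(** * Continuity of the inverse of the moment map *)

Lemma cvg_bounded_mul0 (R : realType) (T : Type) (F : set_system T) {FF : Filter F}
    (f g : T -> R) (C : R) : (\forall t \near F, `|f t| <= C) ->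
  g @ F --> 0 -> f t * g t @[t --> F] --> 0.
Proof.
move=> fC g0; apply/norm_cvg0P; have C0 : 0 <= Num.max C 0 by rewrite le_max lexx orbT.
apply: (@squeeze_cvgr _ _ _ _ (fun=> 0) (fun t => Num.max C 0 * `|g t|)).
- near=> t; rewrite normr_ge0 normrM ler_wpM2r //= le_max; apply/orP; left.
  by near: t.
- exact: cvg_cst.
- rewrite -[X in _ --> X](mulr0 (Num.max C 0)); apply: cvgM; first exact: cvg_cst.
  exact/norm_cvg0P.
Unshelve. all: by end_near. Qed.

(** The lag-zero covariance without the matrix power; see [cov_xi_lag0]. *)
Definition cov0_xi (R : realType) d (K : 'M[R]_d) (xi : gpar R d) : 'M[R]_d :=
  - (p_beta xi / (p_alpha xi - 1)) *: lyap_inv K (p_sigma2 xi).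

(** The eigenvalues of the damping factor f_h(-K) between lags 0 and h. *)
Definition corr (R : realType) d (lam : 'rV[R]_d) (h : R) (xi : gpar R d) : 'rV[R]_d :=
  \row_i (1 + h * lam 0 i / p_beta xi) `^ (- (p_alpha xi - 1)).

(** Factoring b^(1 - a) out of (b + h lam_i)^(1 - a) and merging it with b^a leaves the factor b of
    the lag-zero covariance. *)
Lemma cov_xi_diag (R : realType) d (G : 'M[R]_d) (lam : 'rV[R]_d) (h : R) xi :
  let K := - (invmx G *m diag_mx lam *m G) in
  G \in unitmx -> (forall i, 0 < lam 0 i) -> 0 <= h -> gpar_dom xi ->
  cov_xi K h xi = invmx G *m diag_mx (corr lam h xi) *m G *m cov0_xi K xi.
Proof.
move=> K Gu lam0 h0 [_ a1 b0]; rewrite /cov_xi /cov0_xi.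
set b := p_beta xi in b0 *; set a := p_alpha xi in a1 *.
have pos i : 0 < b + h * lam 0 i by rewrite ltr_wpDr // mulr_ge0 // ltW.
have -> : b%:M - h *: K
    = invmx G *m diag_mx (\row_i (b + h * lam 0 i)) *m invmx (invmx G).
  rewrite invmxK /K scalerN opprK.
  have -> : diag_mx (\row_i (b + h * lam 0 i)) = b%:M + h *: diag_mx lam.
    by apply/matrixP => i j; rewrite !mxE mulrnDl mulrnAr.
  by rewrite mulmxDr mulmxDl -scalemxAr -scalemxAl mul_mx_scalar -scalemxAl mulVmx // scalemx1.
rewrite mx_rpow_diag ?unitmx_inv //; last by move=> i; rewrite mxE.
rewrite [invmx (invmx G)]invmxK -scalemxAr.
have -> : diag_mx (\row_i ((\row_i0 (b + h * lam 0 i0)) 0 i `^ (1 - a)))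
    = b `^ (1 - a) *: diag_mx (corr lam h xi).
  apply/matrixP => i j; rewrite !mxE -/b -/a mulrnAr opprB.
  rewrite -powRM ?(ltW b0) //; last by rewrite addr_ge0 // divr_ge0 ?mulr_ge0 // ltW.
  congr ((_ `^ _) *+ _); field; exact: lt0r_neq0.
rewrite -!scalemxAr -!scalemxAl scalerA; congr (_ *: _).
rewrite mulNr mulrAC -powRD; last by rewrite lt0r_neq0 // implybT.
by rewrite addrCA subrr addr0 powRr1 // ltW.
Qed.

Lemma corr_gt0 (R : realType) d (lam : 'rV[R]_d) (h : R) xi i :
  (forall i, 0 < lam 0 i) -> 0 <= h -> gpar_dom xi -> 0 < corr lam h xi 0 i.
Proof.
move=> lam0 h0 [_ a1 b0]; rewrite mxE powR_gt0 // ltr_wpDr //.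
by rewrite divr_ge0 ?mulr_ge0 // ltW.
Qed.

Lemma corr_le1 (R : realType) d (lam : 'rV[R]_d) (h : R) xi i :
  (forall i, 0 < lam 0 i) -> 0 <= h -> gpar_dom xi -> corr lam h xi 0 i <= 1.
Proof.
move=> lam0 h0 [_ a1 b0]; rewrite mxE -[leRHS](powRr0 (1 + h * lam 0 i / p_beta xi)).
apply: ler_powR; last by lra.
by rewrite lerDl divr_ge0 ?mulr_ge0 // ltW.
Qed.

Lemma eq_near_cvg (R : realType) (T : Type) (F : set_system T) {FF : Filter F}
    (f g : T -> R) (l : R) :
  (\forall t \near F, f t = g t) -> g @ F --> l -> f @ F --> l.
Proof.
move=> fg; apply: cvg_trans; apply: near_eq_cvg.
by apply: filterS fg => t ->.
Qed.

Lemma cvg_sumr (R : realType) (T : Type) (F : set_system T) {FF : Filter F}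
    (I : Type) (r : seq I) (f : I -> T -> R) (a : I -> R) :
  (forall i, f i @ F --> a i) ->
  \sum_(i <- r) f i t @[t --> F] --> \sum_(i <- r) a i.
Proof. by move=> fa; apply: cvg_big => //; exact: add_continuous. Qed.

Lemma cvg_sumr0 (R : realType) (T : Type) (F : set_system T) {FF : Filter F}
    (I : Type) (r : seq I) (f : I -> T -> R) :
  (forall i, f i @ F --> 0) -> \sum_(i <- r) f i t @[t --> F] --> 0.
Proof. by move=> f0; have := cvg_sumr (r := r) f0; rewrite big1 //; apply. Qed.

Lemma ler_mulmx_norm (R : numDomainType) m n p (A : 'M[R]_(m, n)) (B : 'M[R]_(n, p)) i j :
  `|(A *m B) i j| <= \sum_k `|A i k| * `|B k j|.
Proof.
rewrite mxE; apply: le_trans (ler_norm_sum _ _ _) _.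
by apply: ler_sum => k _; rewrite normrM.
Qed.

Section MomentInversion.
Context (R : realType) (d : nat) (G : 'M[R]_d) (lam n : 'rV[R]_d).
Hypotheses (Gu : G \in unitmx) (lam0 : forall i, 0 < lam 0 i).
Hypothesis GG : G^T *m G = diag_mx n.
Let K := - (invmx G *m diag_mx lam *m G).

Let injK X : lyap K X = 0 -> X = 0. Proof. exact: lyap_inj. Qed.

Lemma cov0_sym xi : gpar_dom xi -> (cov0_xi K xi)^T = cov0_xi K xi.
Proof. by move=> [[sym _] _ _]; rewrite /cov0_xi linearZ /= lyap_inv_sym. Qed.

Lemma lyap_cov0 xi :
  lyap K (cov0_xi K xi) = - (p_beta xi / (p_alpha xi - 1)) *: p_sigma2 xi.
Proof.
rewrite -[in RHS](lyap_invK (p_sigma2 xi) injK) /cov0_xi.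
by rewrite /lyap -scalemxAr -scalemxAl scalerDr.
Qed.

(** In the coordinates of [lyap_conj] the Lyapunov equation has a positive multiple of
    [G *m p_sigma2 xi0 *m G^T] on its right side, so [lyap_coercive] applies. *)
Lemma cov0_coercive xi0 : gpar_dom xi0 -> p_sigma2 xi0 != 0 ->
  let S := G *m cov0_xi K xi0 *m G^T in
  exists j c, 0 < c /\ forall del : 'rV[R]_d,
    (forall i k, lam 0 i = lam 0 k -> del 0 i = del 0 k) ->
    c * del 0 j ^+ 2 <= \tr (diag_mx del *m S *m (diag_mx del *m S)).
Proof.
move=> dom0 s0 S; have [[symS psdS] a1 b0] := dom0.
have k0 : 0 < p_beta xi0 / (p_alpha xi0 - 1) by rewrite divr_gt0 // subr_gt0.
have LS : diag_mx lam *m S + S *m diag_mx lam =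
    (p_beta xi0 / (p_alpha xi0 - 1)) *: (G *m p_sigma2 xi0 *m G^T).
  apply: oppr_inj; rewrite -lyap_conj // lyap_cov0.
  by rewrite -scalemxAr -scalemxAl scaleNr.
apply: lyap_coercive => //.
- by rewrite /S !trmx_mul trmxK cov0_sym // mulmxA.
- apply: contraNneq s0 => S0; move: LS; rewrite S0 mulmx0 mul0mx addr0 => /esym/eqP.
  rewrite scaler_eq0 gt_eqF //= => /eqP GsG.
  have GTu : G^T \in unitmx by rewrite unitmx_tr.
  by rewrite -[p_sigma2 _](mulKmx Gu) -[G *m _](mulmxK GTu) GsG mul0mx mulmx0.
- move=> v; rewrite LS -scalemxAr -scalemxAl mxE mulr_ge0 ?(ltW k0) //.
  rewrite (_ : _ *m v^T = (v *m G) *m (p_sigma2 xi0 *m (v *m G)^T)).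
    by have := psdS (v *m G)^T; rewrite /dot trmxK.
  by rewrite trmx_mul !mulmxA.
Qed.

Context (F : set_system (gpar R d)) {FF : Filter F} (xi0 : gpar R d).
Hypotheses (dom0 : gpar_dom xi0) (Fdom : \forall xi \near F, gpar_dom xi).
Hypothesis s0 : p_sigma2 xi0 != 0.

(** Multiplying the difference of the damping matrices by [diag_mx n] turns it into
    [G^T *m diag_mx (del xi) *m G], because G^T G = diag n; a diagonal weight acts entrywise on the
    lower triangle. Applied to the lag-zero covariance at [xi0] this is [E], whose squared trace
    controls del_j by coercivity. *)
Lemma corr_cvg (h : R) j c : 0 <= h -> 0 < c ->
  (let S := G *m cov0_xi K xi0 *m G^T in
   forall del : 'rV[R]_d,
     (forall i k, lam 0 i = lam 0 k -> del 0 i = del 0 k) ->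
     c * del 0 j ^+ 2 <= \tr (diag_mx del *m S *m (diag_mx del *m S))) ->
  (forall i k, cov0_xi K xi i k @[xi --> F] --> cov0_xi K xi0 i k) ->
  (forall i k : 'I_d, (k <= i)%N -> cov_xi K h xi i k @[xi --> F] --> cov_xi K h xi0 i k) ->
  corr lam h xi 0 j @[xi --> F] --> corr lam h xi0 0 j.
Proof.
move=> h0 c0 /= coer S_cvg cov_cvg; set S := cov0_xi K xi0.
pose del xi := corr lam h xi - corr lam h xi0.
have mxB (A B : 'M[R]_d) i k : (A - B) i k = A i k - B i k by rewrite !mxE.
have delE xi i : del xi 0 i = corr lam h xi 0 i - corr lam h xi0 0 i by rewrite !mxE.
pose E xi := G^T *m diag_mx (del xi) *m (G *m S).
have cM xi i : gpar_dom xi -> `|corr lam h xi 0 i| <= 1.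
  by move=> domx; rewrite gtr0_norm ?corr_gt0 ?corr_le1.
have del2 xi i : gpar_dom xi -> `|del xi 0 i| <= 2.
  move=> domx; rewrite delE.
  apply: le_trans (ler_normB _ _) _.
  by have := lerD (cM _ i domx) (cM _ i dom0).
have E_bnd i k : exists C, \forall xi \near F, `|E xi i k| <= C.
  exists (\sum_l (`|G^T i l| * 2) * `|(G *m S) l k|); near=> xi.
  have domx : gpar_dom xi by near: xi.
  apply: le_trans (ler_mulmx_norm _ _ _ _) _; apply: ler_sum => l _.
  by rewrite ler_wpM2r // mul_mx_diag mxE normrM ler_wpM2l // del2.
have E_low (i k : 'I_d) : (k <= i)%N -> E xi i k @[xi --> F] --> 0.
  move=> ki.
  (* [E] equals diag(n) times the increment of cov_h minus [M] times the increment of cov_0. The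
     entries of [M] stay bounded since all correlations lie in (0, 1]. *)
  pose M xi := diag_mx n *m (invmx G *m diag_mx (corr lam h xi) *m G).
  have EE : \forall xi \near F, E xi i k =
      n 0 i * (cov_xi K h xi i k - cov_xi K h xi0 i k)
      - \sum_l M xi i l * (cov0_xi K xi l k - S l k).
    near=> xi; have domx : gpar_dom xi by near: xi.
    have -> : \sum_l M xi i l * (cov0_xi K xi l k - S l k) =
        (M xi *m (cov0_xi K xi - S)) i k.
      by rewrite [RHS]mxE; apply: eq_bigr => l _; rewrite mxB.
    have -> : n 0 i * (cov_xi K h xi i k - cov_xi K h xi0 i k) =
        (diag_mx n *m (cov_xi K h xi - cov_xi K h xi0)) i k.
      by rewrite mul_diag_mx [RHS]mxE mxB.
    rewrite !cov_xi_diag // -/S.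
    rewrite [RHS](_ : _ = (diag_mx n *m (invmx G *m diag_mx (corr lam h xi) *m G *m cov0_xi K xi -
          invmx G *m diag_mx (corr lam h xi0) *m G *m S) -
          M xi *m (cov0_xi K xi - S)) i k); last first.
      by rewrite mxB.
    congr (fun_of_matrix _ i k); rewrite /E /M -GG.
    rewrite /del linearB /= !(mulmxBr, mulmxBl) !mulmxA !mulmxK //.
    by rewrite opprB [RHS]addrC addrA subrK.
  apply: (eq_near_cvg EE).
  rewrite -[X in _ --> X](subrr 0); apply: cvgB.
    rewrite -(mulr0 (n 0 i)); apply: cvgM; first exact: cvg_cst.
    by apply/subr_cvg0; exact: cov_cvg.
  apply: cvg_sumr0 => l; apply: (@cvg_bounded_mul0 _ _ _ _ _ _
    (\sum_a (\sum_b `|diag_mx n i b| * `|(invmx G) b a|) * `|G a l|)).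
    near=> xi; have domx : gpar_dom xi by near: xi.
    rewrite /M !mulmxA; apply: le_trans (ler_mulmx_norm _ _ _ _) _.
    apply: ler_sum => a _; rewrite ler_wpM2r // mul_mx_diag mxE normrM.
    apply: le_trans (ler_wpM2l (normr_ge0 _) (cM _ _ domx)) _.
    by rewrite mulr1 ler_mulmx_norm.
  by apply/subr_cvg0; exact: S_cvg.
(* One of the entries [(i, k)], [(k, i)] is in the lower triangle. *)
have EE_cvg i k : E xi i k * E xi k i @[xi --> F] --> 0.
  have [ki|/ltnW ik] := leqP k i.
    have [C bC] := E_bnd k i.
    under eq_fun do rewrite mulrC.
    by apply: (cvg_bounded_mul0 bC); exact: E_low.
  have [C bC] := E_bnd i k.
  by apply: (cvg_bounded_mul0 bC); exact: E_low.
have tr_cvg : \tr (E xi *m E xi) @[xi --> F] --> 0.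
  apply: cvg_sumr0 => i; under eq_fun do rewrite mxE.
  by apply: cvg_sumr0 => k.
(* Cyclicity of the trace moves [G^T] to the end and produces the congruence-transformed
   covariance. *)
have del_tr xi : c * del xi 0 j ^+ 2 <= \tr (E xi *m E xi).
  have -> : \tr (E xi *m E xi) = \tr (diag_mx (del xi) *m (G *m S *m G^T) *m
      (diag_mx (del xi) *m (G *m S *m G^T))).
    by rewrite /E -!mulmxA mxtrace_mulC !mulmxA.
  apply: coer => i k ik; rewrite /del /corr !mxE ik //.
apply/subr_cvg0/cvgr0Pnorm_lt => eps eps0.
move/cvgr0Pnorm_lt: tr_cvg => /(_ (c * eps ^+ 2)); rewrite mulr_gt0 ?exprn_gt0 // => /(_ isT) h'.
near=> xi; rewrite -ltr_sqr ?nnegrE ?(ltW eps0) // real_normK ?num_real //.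
rewrite -(ltr_pM2l c0).
rewrite -delE.
apply: le_lt_trans (del_tr xi) _; apply: le_lt_trans (ler_norm _) _.
by near: xi.
Unshelve. all: by end_near. Qed.

Lemma cov_xi_lag0 xi : gpar_dom xi -> cov_xi K 0 xi = cov0_xi K xi.
Proof.
move=> domx; rewrite cov_xi_diag // (_ : corr lam 0 xi = const_mx 1).
  by rewrite diag_const_mx mulmx1 mulVmx // mul1mx.
by apply/rowP => i; rewrite !mxE !mul0r addr0 powR1.
Qed.

(** Lag 0 gives the full covariance by symmetry. Lags Delta and 2 Delta give the correlation at one
    common index j, hence alpha and beta; multiplication by K and the Lyapunov equation then return
    the two moment parameters. *)
Lemma gpar_cvg (Delta : R) : 0 < Delta ->
  (forall i, mean_xi K xi i 0 @[xi --> F] --> mean_xi K xi0 i 0) ->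
  (forall k (i j : 'I_d), (k <= 2)%N -> (j <= i)%N ->
    cov_xi K (k%:R * Delta) xi i j @[xi --> F] --> cov_xi K (k%:R * Delta) xi0 i j) ->
  [/\ p_alpha xi @[xi --> F] --> p_alpha xi0,
      p_beta xi @[xi --> F] --> p_beta xi0,
      forall i, p_mu xi i 0 @[xi --> F] --> p_mu xi0 i 0 &
      forall i j, p_sigma2 xi i j @[xi --> F] --> p_sigma2 xi0 i j].
Proof.
move=> D0 mean_cvg cov_cvg; have [_ a01 b00] := dom0.
have S_low (i j : 'I_d) : (j <= i)%N -> cov0_xi K xi i j @[xi --> F] --> cov0_xi K xi0 i j.
  move=> ji; rewrite -cov_xi_lag0 //; apply: (@eq_near_cvg _ _ _ _ _ (fun xi => cov_xi K 0 xi i j)).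
    by apply: filterS Fdom => xi domx; rewrite cov_xi_lag0.
  by have := cov_cvg 0%N i j isT ji; rewrite mul0r.
have S_cvg (i j : 'I_d) : cov0_xi K xi i j @[xi --> F] --> cov0_xi K xi0 i j.
  have [ji|/ltnW ij] := leqP j i; first exact: S_low.
  rewrite -cov0_sym // mxE; apply: (@eq_near_cvg _ _ _ _ _ (fun xi => cov0_xi K xi j i)).
    by apply: filterS Fdom => xi domx; rewrite -[in LHS]cov0_sym // mxE.
  exact: S_low.
have [j [c [c0 coer]]] := cov0_coercive dom0 s0.
have corrk k : (k <= 2)%N ->
    corr lam (k%:R * Delta) xi 0 j @[xi --> F] --> corr lam (k%:R * Delta) xi0 0 j.
  move=> k2; apply: (corr_cvg _ c0 coer) => //; first by rewrite mulr_ge0 // ltW.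
  by move=> i l; exact: cov_cvg.
have [xcvg acvg] : Delta * lam 0 j / p_beta xi @[xi --> F] --> Delta * lam 0 j / p_beta xi0 /\
    p_alpha xi - 1 @[xi --> F] --> p_alpha xi0 - 1.
  apply: powR_pair_cvg.
  - by rewrite divr_gt0 // mulr_gt0.
  - by rewrite subr_gt0.
  - apply: filterS Fdom => xi [_ a1 b0]; split; last by rewrite subr_gt0.
    by rewrite divr_gt0 // mulr_gt0.
  - have := corrk 1%N isT; rewrite !mxE mul1r.
    by under eq_fun do rewrite mxE.
  - have E2 xi : corr lam (2 * Delta) xi 0 j =
        (1 + 2 * (Delta * lam 0 j / p_beta xi)) `^ (- (p_alpha xi - 1)).
      by rewrite mxE !mulrA.
    by have := corrk 2%N isT; rewrite E2; under eq_fun do rewrite E2.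
have alpha_cvg : p_alpha xi @[xi --> F] --> p_alpha xi0.
  rewrite -(subrK 1 (p_alpha xi0)); under eq_fun do rewrite -[p_alpha _](subrK 1).
  by apply: cvgD => //; exact: cvg_cst.
have Dl : Delta * lam 0 j != 0 by rewrite mulf_neq0 ?gt_eqF.
have beta_cvg : p_beta xi @[xi --> F] --> p_beta xi0.
  have invE (b : R) : b = (Delta * lam 0 j) * (Delta * lam 0 j / b)^-1.
    by rewrite invf_div mulrCA divff // mulr1.
  rewrite [p_beta xi0]invE; under eq_fun do rewrite [p_beta _]invE.
  apply: cvgM; first exact: cvg_cst.
  by apply: cvgV => //; rewrite mulf_neq0 // invr_eq0 gt_eqF.
have r_cvg : (p_alpha xi - 1) / p_beta xi @[xi --> F] --> (p_alpha xi0 - 1) / p_beta xi0.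
  by apply: cvgM => //; apply: cvgV => //; rewrite gt_eqF.
split=> //.
- have muE xi : gpar_dom xi ->
      p_mu xi = - ((p_alpha xi - 1) / p_beta xi) *: (K *m mean_xi K xi).
    move=> [_ a1 b0]; have Ku : K \in unitmx.
      have dl : diag_mx lam \in unitmx.
        rewrite unitmxE det_diag unitfE; apply/prodf_neq0 => i _.
        by rewrite gt_eqF.
      rewrite /K -scaleN1r unitmxZ ?unitrN1 // !unitmx_mul Gu dl unitmx_inv Gu //.
    rewrite /mean_xi -scalemxAr mulKVmx // scalerA mulrNN.
    rewrite (_ : _ * _ = 1) ?scale1r //; field.
    by rewrite !gt_eqF // subr_gt0.
  move=> i; rewrite muE // !mxE.
  apply: (@eq_near_cvg _ _ _ _ _ (fun xi =>
    - ((p_alpha xi - 1) / p_beta xi) * \sum_k K i k * mean_xi K xi k 0)).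
    by apply: filterS Fdom => xi domx; rewrite muE // mxE [in LHS]mxE.
  apply: cvgM; first exact: cvgN.
  by apply: cvg_sumr => k; apply: cvgM => //; exact: cvg_cst.
- have sE xi : gpar_dom xi ->
      p_sigma2 xi = - ((p_alpha xi - 1) / p_beta xi) *: lyap K (cov0_xi K xi).
    move=> [_ a1 b0]; rewrite lyap_cov0 scalerA mulrNN.
    rewrite (_ : _ * _ = 1) ?scale1r //; field.
    by rewrite !gt_eqF // subr_gt0.
  move=> i k; rewrite sE // !mxE.
  apply: (@eq_near_cvg _ _ _ _ _ (fun xi =>
    - ((p_alpha xi - 1) / p_beta xi) * (\sum_l K i l * cov0_xi K xi l k +
       \sum_l cov0_xi K xi i l * K^T l k))).
    by apply: filterS Fdom => xi domx; rewrite sE // mxE /lyap 3![in LHS]mxE.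
  apply: cvgM; first exact: cvgN.
  by apply: cvgD; apply: cvg_sumr => l; apply: cvgM => //; exact: cvg_cst.
Qed.

End MomentInversion.

(* [gmm_f K Delta x xi + gmm_moments m K Delta xi] depends on [x] only; the
   window [x = 0] isolates the part depending on [xi]. *)
Definition gmm_moments (R : realType) d m (K : 'M[R]_d) (Delta : R) (xi : gpar R d)
  : 'cV[R]_(gmm_dim d m) := - gmm_f K Delta (fun=> 0) xi.

Lemma gmm_fB (R : realType) d m (K : 'M[R]_d) (Delta : R)
    (x : 'I_m.+1 -> 'cV[R]_d) (xi xi' : gpar R d) :
  gmm_f K Delta x xi =
  gmm_f K Delta x xi' + (gmm_moments m K Delta xi' - gmm_moments m K Delta xi).
Proof.
rewrite /gmm_moments /gmm_f !opp_col_mx !add_col_mx; congr col_mx.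
  by apply/matrixP => i j; rewrite !mxE; ring.
apply/matrixP => i j; rewrite !mxE /=; ring.
Qed.

Lemma gmm_moments_mean (R : realType) d m (K : 'M[R]_d) (Delta : R) i xi :
  gmm_moments m K Delta xi (lshift _ i) 0 = mean_xi K xi i 0.
Proof. by rewrite /gmm_moments mxE /gmm_f col_mxEu mxE mxE add0r mxE opprK. Qed.

(** [tagnat.Rank] is the indexing of blocks stacked by [mxcol]; [ji] witnesses the nonemptiness that
    [enum_rank_in] requires. *)
Definition vech_index d m (k : 'I_m.+1) (i j : 'I_d) (ji : (i, j) \in lowtri d)
  : 'I_(gmm_dim d m) :=
  rshift d (@tagnat.Rank m.+1 (fun=> #|lowtri d|) k (enum_rank_in ji (i, j))).

Lemma gmm_f_vech (R : realType) d m (K : 'M[R]_d) (Delta : R)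
    (x : 'I_m.+1 -> 'cV[R]_d) xi k i j (ji : (i, j) \in lowtri d) :
  (gmm_f K Delta x xi : 'cV[R]_(gmm_dim d m)) (vech_index k ji) 0 =
  x ord0 i 0 * x k j 0 - cov_xi K (k%:R * Delta) xi i j
  - mean_xi K xi i 0 * mean_xi K xi j 0.
Proof.
rewrite /gmm_f /vech_index col_mxEd.
set B := mxcol _; transitivity (submxcol B k (enum_rank_in ji (i, j)) 0).
  by rewrite [RHS]mxE.
by rewrite mxcolK /vech mxE enum_rankK_in // !mxE !big_ord1 !mxE.
Qed.

(** Supplies the tolerance for g_N(xi0) that survives a loss of the factor C in squared norm. *)
Lemma exists_small_sqr (R : realType) (del C : R) : 0 < del -> 0 <= C ->
  exists eta, [/\ 0 < eta, eta <= del & C * eta ^+ 2 < del ^+ 2].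
Proof.
move=> d0 C0; exists (del / (1 + C)); have C1 : 0 < 1 + C by lra.
split; first by rewrite divr_gt0.
  by rewrite ler_pdivrMr // ler_peMr ?lerDl // ltW.
rewrite expr_div_n mulrCA gtr_pMr ?exprn_gt0 // ltr_pdivrMr ?exprn_gt0 //; nra.
Qed.

Lemma gmm_moments_cov (R : realType) d m (K : 'M[R]_d) (Delta : R) xi k i j
    (ji : (i, j) \in lowtri d) :
  gmm_moments m K Delta xi (vech_index k ji) 0 =
  cov_xi K (k%:R * Delta) xi i j + mean_xi K xi i 0 * mean_xi K xi j 0.
Proof. rewrite /gmm_moments mxE gmm_f_vech mxE; ring. Qed.

(** * Moments close to those of the true parameter force a close parameter *)

Section Identification.
Context (R : realType) (d m : nat) (K : 'M[R]_d) (Delta : R) (xi0 : gpar R d).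

Let moments xi := gmm_moments m K Delta xi.

(** The neighbourhoods of the true moments pulled back to the parameter domain. Convergence along
    this filter expresses continuity of the inverse moment map at [xi0], without sequences or a
    topology on [gpar]. *)
Definition moment_filter : set_system (gpar R d) :=
  [set A | exists2 del, 0 < del & forall xi, gpar_dom xi ->
     (forall i, `|moments xi i 0 - moments xi0 i 0| < del) -> A xi].

#[global] Instance moment_filter_filter : Filter moment_filter.
Proof.
split.
- by exists 1.
- move=> A B [a a0 aA] [b b0 bB]; exists (Num.min a b); first by rewrite lt_min a0.
  move=> xi domx h; split; [apply: aA|apply: bB] => // i;
    by apply: lt_le_trans (h i) _; rewrite ge_min lexx ?orbT.
- by move=> A B AB [a a0 aA]; exists a => // xi domx h; apply/AB/aA.
Qed.

Lemma moment_filter_dom : \forall xi \near moment_filter, gpar_dom xi.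
Proof. by exists 1. Qed.

Lemma moments_cvg i : moments xi i 0 @[xi --> moment_filter] --> moments xi0 i 0.
Proof.
apply/(@cvgrPdist_lt _ _ _ _ _ (fun xi => moments xi i 0)) => eps eps0.
exists eps; first exact: eps0.
by move=> xi _ h; rewrite distrC; exact: h.
Qed.

Lemma moments_identify (G : 'M[R]_d) (lam n : 'rV[R]_d) : G \in unitmx -> (forall i, 0 < lam 0 i) ->
  G^T *m G = diag_mx n -> K = - (invmx G *m diag_mx lam *m G) ->
  0 < Delta -> (2 <= m)%N -> gpar_dom xi0 -> p_sigma2 xi0 != 0 ->
  forall eps : R, 0 < eps -> exists2 del, 0 < del & forall xi, gpar_dom xi ->
    (forall i, `|moments xi i 0 - moments xi0 i 0| < del) -> gpar_dist xi xi0 < eps.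
Proof.
move=> Gu lam0 GG KE D0 m2 dom0 s0 eps eps0.
have mean_cvg i : mean_xi K xi i 0 @[xi --> moment_filter] --> mean_xi K xi0 i 0.
  have := @moments_cvg (lshift _ i); rewrite /moments gmm_moments_mean.
  by under eq_fun do rewrite gmm_moments_mean.
have cov_cvg k (i j : 'I_d) : (k <= 2)%N -> (j <= i)%N ->
    cov_xi K (k%:R * Delta) xi i j @[xi --> moment_filter] --> cov_xi K (k%:R * Delta) xi0 i j.
  move=> k2 ji; have km : (k < m.+1)%N by rewrite ltnS (leq_trans k2).
  have jiP : (i, j) \in lowtri d by rewrite finset.inE.
  have := @moments_cvg (vech_index (Ordinal km) jiP).
  rewrite /moments gmm_moments_cov /=; under eq_fun do rewrite gmm_moments_cov /=.
  have E xi : cov_xi K (k%:R * Delta) xi i j = cov_xi K (k%:R * Delta) xi i j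
      + mean_xi K xi i 0 * mean_xi K xi j 0 - mean_xi K xi i 0 * mean_xi K xi j 0.
    by rewrite addrK.
  move=> h; rewrite E; under eq_fun do rewrite E.
  by apply: cvgB => //; apply: cvgM.
have [acvg bcvg mucvg scvg] : [/\ p_alpha xi @[xi --> moment_filter] --> p_alpha xi0,
      p_beta xi @[xi --> moment_filter] --> p_beta xi0,
      forall i, p_mu xi i 0 @[xi --> moment_filter] --> p_mu xi0 i 0 &
      forall i j, p_sigma2 xi i j @[xi --> moment_filter] --> p_sigma2 xi0 i j].
  move: mean_cvg cov_cvg; rewrite KE => mean_cvg cov_cvg.
  exact: (gpar_cvg Gu lam0 GG dom0 moment_filter_dom s0 D0 mean_cvg cov_cvg).
have sqr_cvg (f : gpar R d -> R) : f @ moment_filter --> f xi0 ->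
    (f xi - f xi0) ^+ 2 @[xi --> moment_filter] --> 0.
  move=> /subr_cvg0 h; rewrite -(mulr0 0); under eq_fun do rewrite expr2.
  exact: cvgM.
have enorm_cvg p q (f : gpar R d -> 'M[R]_(p, q)) :
    (forall i j, f xi i j @[xi --> moment_filter] --> f xi0 i j) ->
    enorm (f xi - f xi0) ^+ 2 @[xi --> moment_filter] --> 0.
  move=> h; have E xi : enorm (f xi - f xi0) ^+ 2 = \sum_i \sum_j (f xi i j - f xi0 i j) ^+ 2.
    rewrite /enorm sqr_sqrtr; last first.
      by apply: sumr_ge0 => i _; apply: sumr_ge0 => j _; rewrite sqr_ge0.
    by apply: eq_bigr => i _; apply: eq_bigr => j _; rewrite !mxE.
  under eq_fun do rewrite E.
  by apply: cvg_sumr0 => i; apply: cvg_sumr0 => j; apply: (sqr_cvg (fun xi => f xi i j)).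
have : gpar_dist xi xi0 ^+ 2 @[xi --> moment_filter] --> 0.
  have E xi : gpar_dist xi xi0 ^+ 2 = enorm (p_mu xi - p_mu xi0) ^+ 2
            + enorm (p_sigma2 xi - p_sigma2 xi0) ^+ 2
            + (p_alpha xi - p_alpha xi0) ^+ 2 + (p_beta xi - p_beta xi0) ^+ 2.
    by rewrite /gpar_dist sqr_sqrtr // !addr_ge0 ?sqr_ge0.
  under eq_fun do rewrite E.
  rewrite -(addr0 0); apply: cvgD; last exact: sqr_cvg.
  rewrite -(addr0 0); apply: cvgD; last exact: sqr_cvg.
  rewrite -(addr0 0); apply: cvgD; last exact: enorm_cvg.
  by apply: enorm_cvg => i j; rewrite [j]ord1.
move=> /cvgr0Pnorm_lt/(_ (eps ^+ 2)); rewrite exprn_gt0 // => /(_ isT) [del del0 h].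
exists del => // xi domx /(h _ domx); rewrite ger0_norm ?sqr_ge0 //.
by rewrite ltr_sqr // nnegrE ?sqrtr_ge0 // ltW.
Qed.

End Identification.

(** * Probability *)

Lemma dot_self (R : realType) n (u : 'cV[R]_n) : dot u u = \sum_i u i 0 ^+ 2.
Proof. by rewrite /dot mxE; apply: eq_bigr => i _; rewrite mxE expr2. Qed.

Lemma ler_entry_enorm (R : realType) p q (M : 'M[R]_(p, q)) i j : `|M i j| <= enorm M.
Proof.
rewrite /enorm -sqrtr_sqr ler_wsqrtr // (bigD1 i) //= (bigD1 j) //= -addrA lerDl.
by rewrite addr_ge0 ?sumr_ge0 // => k _; rewrite ?sumr_ge0 // => *; rewrite sqr_ge0.
Qed.

Lemma ler_quad_enorm (R : realType) n (M : 'M[R]_n) (u : 'cV[R]_n) :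
  `|dot u (M *m u)| <= n%:R * enorm M * dot u u.
Proof.
rewrite /dot mxE; apply: le_trans (ler_norm_sum _ _ _) _.
apply: (@le_trans _ _ (\sum_i \sum_j enorm M * ((u i 0 ^+ 2 + u j 0 ^+ 2) / 2))).
  apply: ler_sum => i _; rewrite !mxE mulr_sumr.
  apply: le_trans (ler_norm_sum _ _ _) _; apply: ler_sum => j _.
  rewrite mulrCA normrM ler_pM ?ler_entry_enorm // normrM.
  have := sqr_ge0 (`|u i 0| - `|u j 0|).
  rewrite -[u i 0 ^+ 2]real_normK ?num_real // -[u j 0 ^+ 2]real_normK ?num_real //; nra.
under eq_bigr do rewrite -mulr_sumr -mulr_suml big_split /= sumr_const card_ord.
rewrite -/(dot u u) -dot_self -mulr_sumr -mulr_suml big_split /=.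
rewrite sumr_const card_ord sumrMnl -dot_self.
rewrite le_eqVlt; apply/orP; left; apply/eqP.
by rewrite -[_ *+ n]mulr_natl; field.
Qed.

(** The perturbation bound puts the form of [V] between lo/2 and |hi| + lo/2 times the squared norm;
    the constant is the quotient of these bounds. The denominator n + 1 avoids division by zero for
    n = 0. *)
Lemma argmin_dot_le (R : realType) n (V Vb : 'M[R]_n) (lo hi : R) (g z : 'cV[R]_n) :
  0 < lo -> (forall u : 'cV[R]_n, lo * dot u u <= dot u (Vb *m u) <= hi * dot u u) ->
  enorm (V - Vb) < lo / 2 / n.+1%:R ->
  dot g (V *m g) <= dot z (V *m z) ->
  dot g g <= (2 * `|hi| / lo + 1) * dot z z.
Proof.
move=> lo0 hVb; rewrite ltr_pdivlMr ?ltr0Sn // => hV gz.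
have dot0 (u : 'cV[R]_n) : 0 <= dot u u.
  by rewrite dot_self sumr_ge0 // => i _; rewrite sqr_ge0.
have nV : n%:R * enorm (V - Vb) <= lo / 2.
  apply: ltW; apply: le_lt_trans hV; rewrite mulrC ler_wpM2l ?sqrtr_ge0 //.
  by rewrite ler_nat.
have VE (u : 'cV[R]_n) : dot u (V *m u) = dot u (Vb *m u) + dot u ((V - Vb) *m u).
  by rewrite /dot mulmxBl mulmxBr [X in _ = _ + X]mxE [X in _ = _ + (_ + X)]mxE addrC subrK.
have bnd (u : 'cV[R]_n) : `|dot u ((V - Vb) *m u)| <= lo / 2 * dot u u.
  by apply: le_trans (ler_quad_enorm _ _) _; rewrite ler_wpM2r.
have /andP[g1 _] := hVb g; have /andP[_ z2] := hVb z.
have /ler_normlP [g3 _] := bnd g; have /ler_normlP [_ z3] := bnd z.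
move: gz; rewrite !VE => gz.
have z4 : hi * dot z z <= `|hi| * dot z z by rewrite ler_wpM2r // ler_norm.
rewrite -(ler_pM2l lo0); have -> : lo * ((2 * `|hi| / lo + 1) * dot z z) =
  2 * `|hi| * dot z z + lo * dot z z by field; rewrite gt_eqF.
lra.
Qed.

(** * Events of vanishing probability *)

Section Vanishing.
Context (R : realType) (disp : measure_display) (Omega : measurableType disp).
Context (P : probability Omega R).

Definition vanishing (A : nat -> set Omega) :=
  (\forall N \near \oo, measurable (A N)) /\ P (A N) @[N --> \oo] --> 0%E.

Lemma vanishing_le (A B : nat -> set Omega) :
  (\forall N \near \oo, measurable (B N) /\ (P (B N) <= P (A N))%E) ->
  vanishing A -> vanishing B.
Proof.
move=> BA [mA A0]; split; first by apply: filterS BA => N [].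
apply: (@squeeze_cvge _ _ _ _ (fun=> 0%E) _ (fun N => P (A N))) => //.
  by apply: filterS BA => N [_ ->]; rewrite measure_ge0.
exact: cvg_cst.
Qed.

(** The estimator minimizes only almost surely, so the inclusions of events hold up to a null
    set. *)
Lemma vanishing_ae_sub (A B : nat -> set Omega) :
  (\forall N \near \oo, measurable (B N) /\ {ae P, forall w, B N w -> A N w}) ->
  vanishing A -> vanishing B.
Proof.
move=> BA [mA A0]; apply: (vanishing_le _ (conj mA A0)).
near=> N; have [mB [Z [mZ Z0 QZ]]] : measurable (B N) /\ {ae P, forall w, B N w -> A N w}.
  by near: N.
have mAN : measurable (A N) by near: N.
split=> //; apply: (@le_trans _ _ (P (A N `|` Z))).
  apply: le_measure; rewrite ?inE //; first exact: measurableU.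
  move=> w Bw; have [Aw|nAw] := pselect (A N w); first by left.
  by right; apply: QZ => /= /(_ Bw).
apply: le_trans (measureU2 _ _ _) _ => //; rewrite -[leRHS]adde0.
have Z0le : (P Z <= 0)%E by rewrite Z0.
exact: leeD2l Z0le.
Unshelve. all: by end_near. Qed.

Lemma vanishingU (A B : nat -> set Omega) :
  vanishing A -> vanishing B -> vanishing (fun N => A N `|` B N).
Proof.
move=> [mA A0] [mB B0]; split.
  near=> N; apply: measurableU; by near: N.
apply: (@squeeze_cvge _ _ _ _ (fun=> 0%E) _ (fun N => P (A N) + P (B N))%E).
- near=> N; rewrite measure_ge0 measureU2 //; by near: N.
- exact: cvg_cst.
- by rewrite -[X in _ --> X](adde0 0%E); apply: cvgeD.
Unshelve. all: by end_near. Qed.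

Lemma vanishing_bigU (I : Type) (r : seq I) (A : I -> nat -> set Omega) :
  (forall i, vanishing (A i)) -> vanishing (fun N => \big[setU/set0]_(i <- r) A i N).
Proof.
move=> A0; elim: r => [|i r IH].
  under eq_fun do rewrite big_nil.
  split; first by near=> N.
  by under eq_fun do rewrite measure0; exact: cvg_cst.
under eq_fun do rewrite big_cons; exact: vanishingU.
Unshelve. all: by end_near. Qed.

End Vanishing.

(** The average of N - m equal differences is that difference. For N <= m the sum is empty and
    [gmm_g] is 0, hence the condition on N. *)
Lemma gmm_gB (R : realType) T d m (K : 'M[R]_d) (Delta : R)
    (X : R -> T -> 'cV[R]_d) (N : nat) (w : T) (xi xi' : gpar R d) : (m < N)%N ->
  gmm_g m K Delta X N w xi =
  gmm_g m K Delta X N w xi' + (gmm_moments m K Delta xi' - gmm_moments m K Delta xi).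
Proof.
move=> mN; have n0 : (N - m)%:R != 0 :> R by rewrite pnatr_eq0 subn_eq0 -ltnNge.
rewrite /gmm_g (eq_bigr _ (fun t _ => gmm_fB K Delta (obs_window Delta X t w) xi xi')).
rewrite big_split /= sumr_const_nat subn1 /= scalerDr; congr (_ + _).
by rewrite -[X in _ *: X]scaler_nat scalerA mulVf // scale1r.
Qed.

(** * Measurability and expectations of the sample moments *)

Section Probability.
Context (R : realType) (disp : measure_display) (Omega : measurableType disp).
Context (P : probability Omega R).

Lemma measurable_le_set (f : Omega -> R) (c : R) : measurable_fun [set: Omega] f ->
  measurable [set w | c <= f w].
Proof.
move=> mf; rewrite (_ : [set _ | _] = [set: Omega] `&` f @^-1` `[c, +oo[).
  exact: mf.
by rewrite setTI; apply/seteqP; split => w /=; rewrite in_itv /= andbT.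
Qed.

Lemma measurable_enorm p q (Y : Omega -> 'M[R]_(p, q)) (C : 'M[R]_(p, q)) :
  rmx_measurable Y -> measurable_fun [set: Omega] (fun w => enorm (Y w - C)).
Proof.
move=> mY; apply: (measurableT_comp (continuous_measurable_fun (@sqrt_continuous R))).
apply: measurable_sum => i; apply: measurable_sum => j; apply: measurable_funX.
under eq_fun do rewrite !mxE.
by apply: measurable_funB => //; exact: mY.
Qed.

Lemma measurable_gpar_dist d (Y : Omega -> gpar R d) (xi : gpar R d) :
  gpar_measurable Y -> measurable_fun [set: Omega] (fun w => gpar_dist (Y w) xi).
Proof.
move=> [mmu ms ma mb].
apply: (measurableT_comp (continuous_measurable_fun (@sqrt_continuous R))).
apply: measurable_funD; [apply: measurable_funD; [apply: measurable_funD|]|];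
  apply: measurable_funX; rewrite -?/(enorm _).
- exact: measurable_enorm.
- exact: measurable_enorm.
- by apply: measurable_funB.
- by apply: measurable_funB.
Qed.

Context (d m : nat) (K : 'M[R]_d) (Delta : R) (X : R -> Omega -> 'cV[R]_d).

Definition gmm_integrable t xi := forall i, P.-integrable setT (fun w =>
  ((gmm_f K Delta (obs_window Delta X t w) xi : 'cV[R]_(gmm_dim d m)) i 0)%:E).

Lemma gmm_EfB t xi xi' : gmm_integrable t xi' ->
  gmm_Ef P m K Delta X t xi =
  gmm_Ef P m K Delta X t xi' + (gmm_moments m K Delta xi' - gmm_moments m K Delta xi).
Proof.
move=> int'; apply/matrixP => i j; rewrite ord1.
set D := gmm_moments _ _ _ _ - _; rewrite [LHS]mxE [RHS]mxE [X in _ = X + _]mxE.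
under eq_Rintegral do rewrite (gmm_fB _ _ _ _ xi') -/D mxE.
rewrite RintegralD //; [|exact: int'|exact: finite_measure_integrable_cst].
rewrite Rintegral_cst // [fine _](_ : _ = 1) ?mulr1 //.
exact: (congr1 fine (probability_setT P)).
Qed.

Lemma measurable_gmm_g N xi i : (forall t, (0 < t)%N -> gmm_integrable t xi) ->
  measurable_fun [set: Omega] (fun w => gmm_g m K Delta X N w xi i 0).
Proof.
move=> int; have E w : gmm_g m K Delta X N w xi i 0 = ((N - m)%:R)^-1 *
    \sum_(t < N - m) (gmm_f K Delta (obs_window Delta X t.+1 w) xi : 'cV[R]_(gmm_dim d m)) i 0.
  by rewrite /gmm_g mxE big_add1 /= big_mkord summxE.
under eq_fun do rewrite E.
apply: measurable_funM => //; apply: measurable_sum => t.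
by have /measurable_int := int t.+1 isT i; move/measurable_EFinP.
Qed.

Lemma cov_xi_degenerate h xi : p_sigma2 xi = 0 -> cov_xi K h xi = 0.
Proof.
by move=> s0; rewrite /cov_xi s0 /lyap_inv linear0 mul0mx linear0 mulmx0 scaler0.
Qed.

(* The first two moments give [X] zero variance. *)
Lemma obs_degenerate t xi : p_sigma2 xi = 0 -> gmm_integrable t xi ->
  gmm_Ef P m K Delta X t xi = 0 ->
  {ae P, forall w i, X (t%:R * Delta) w i 0 = mean_xi K xi i 0}.
Proof.
move=> s0 int Ef0.
pose f w : 'cV[R]_(gmm_dim d m) := gmm_f K Delta (obs_window Delta X t w) xi.
have Ef i : \int[P]_w f w i 0 = 0.
  by have := congr1 (fun M : 'cV[R]_(gmm_dim d m) => M i 0) Ef0; rewrite !mxE.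
have win w : obs_window Delta X t w (ord0 : 'I_m.+1) = X (t%:R * Delta) w.
  by rewrite /obs_window addn0.
have f1 w i : f w (lshift _ i) 0 = X (t%:R * Delta) w i 0 - mean_xi K xi i 0.
  by rewrite /f /gmm_f col_mxEu win !mxE.
have f2 w i (ii : (i, i) \in lowtri d) : f w (vech_index ord0 ii) 0 =
    X (t%:R * Delta) w i 0 ^+ 2 - mean_xi K xi i 0 ^+ 2.
  by rewrite /f gmm_f_vech win cov_xi_degenerate // mxE subr0 !expr2.
apply: filter_forall => i.
have ii : (i, i) \in lowtri d by rewrite finset.inE leqnn.
pose mu := mean_xi K xi i 0.
pose q1 := lshift (\sum_(k < m.+1) #|lowtri d|) i; pose q2 := vech_index (ord0 : 'I_m.+1) ii.
(* (X^2 - mu^2) - 2 mu (X - mu) = (X - mu)^2, a nonnegative variable of expectation zero. *)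
pose g w := f w q2 0 - 2 * mu * f w q1 0.
have gE w : g w = (X (t%:R * Delta) w i 0 - mu) ^+ 2.
  rewrite /g f1 f2 -/mu; ring.
have int1 : P.-integrable setT (EFin \o (fun w => 2 * mu * f w q1 0)).
  have -> : EFin \o (fun w => 2 * mu * f w q1 0) =
      (fun w => (2 * mu)%:E * (f w q1 0)%:E)%E by apply/funext => w /=; rewrite EFinM.
  by apply: integrableZl => //; exact: int.
have intg : P.-integrable setT (EFin \o g).
  have -> : EFin \o g = (fun w => (f w q2 0)%:E - (2 * mu * f w q1 0)%:E)%E.
    by apply/funext => w /=; rewrite EFinB.
  by apply: integrableB => //; exact: int.
have intg0 : (\int[P]_w (g w)%:E = 0)%E.
  rewrite -[LHS]fineK; last exact: integrable_fin_num.
  have -> : fine (\int[P]_w (g w)%:E) = \int[P]_w g w by [].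
  rewrite RintegralB //; last exact: int.
  rewrite RintegralZl //; last exact: int.
  by rewrite !Ef mulr0 subrr.
have := (ae_eq_integral_abs P measurableT (measurable_int _ intg)).1.
have -> : (\int[P]_w `|(EFin \o g) w| = 0)%E.
  rewrite -[RHS]intg0; apply: eq_integral => w _ /=.
  by rewrite gE ger0_norm ?sqr_ge0.
move=> /(_ erefl); apply: filterS => w /(_ I) /= [] /eqP.
by rewrite gE sqrf_eq0 subr_eq0 => /eqP.
Qed.

(** A single null set serves the countably many observation times; off it every observation equals
    the mean and each summand vanishes. *)
Lemma gmm_g_degenerate N xi : p_sigma2 xi = 0 -> (forall t, (0 < t)%N -> gmm_integrable t xi) ->
  (forall t, (0 < t)%N -> gmm_Ef P m K Delta X t xi = 0) ->
  {ae P, forall w, gmm_g m K Delta X N w xi = 0}.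
Proof.
move=> s0 int Ef0.
have : {ae P, forall w t, (0 < t)%N -> forall i, X (t%:R * Delta) w i 0 = mean_xi K xi i 0}.
  apply: ae_foralln => -[|t]; first exact: aeW.
  by have := obs_degenerate s0 (int t.+1 isT) (Ef0 t.+1 isT); apply: filterS => w.
apply: filterS => w XE; rewrite /gmm_g big_nat big1 ?scaler0 // => t /andP[t0 _].
have XE' k : obs_window Delta X t w (k : 'I_m.+1) = mean_xi K xi.
  by apply/matrixP => i j; rewrite ord1 /obs_window XE // ltn_addr.
rewrite /gmm_f XE' subrr; apply/eqP; rewrite col_mx_eq0 eqxx /=; apply/eqP.
apply/matrixP => i j; rewrite mxE XE' cov_xi_degenerate // subr0.
by rewrite !mxE subrr.
Qed.

End Probability.

(** * Weak consistency of the estimator *)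

Lemma gpar_dist_self (R : realType) d (xi : gpar R d) : gpar_dist xi xi = 0.
Proof.
have e0 p q : enorm (0 : 'M[R]_(p, q)) = 0.
  rewrite /enorm big1 ?sqrtr0 // => i _; rewrite big1 // => j _.
  by rewrite mxE expr0n.
by rewrite /gpar_dist !subrr !e0 expr0n !addr0 sqrtr0.
Qed.

Theorem theorem5p4 (R : realType) (disp : measure_display)
  (Omega : measurableType disp) (P : probability Omega R)
  (d : nat) (hd : (0 < d)%N)
  (e : rel 'I_d) (he_sym : symmetric e) (he_irr : irreflexive e)
  (c : R) (hc : `|c| < 1)
  (gamma : 'cV[R]_d) (Sigma : 'M[R]_d) (hSigma : possemidefmx Sigma)
  (nu : {measure set (mxb R d 1) -> \bar R}) (hnu : levy_measure nu)
  (hnu2 : (\int[nu]_(x in [set x : mxb R d 1 | (1 < enorm (x : 'cV[R]_d))%R])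
             (enorm (x : 'cV[R]_d) ^+ 2)%:E < +oo)%E)
  (W : set (gpar R d)) (hW : W `<=` @gpar_dom R d)
  (xi0 : gpar R d) (hxi0 : W xi0)
  (hmu0 : p_mu xi0 = mu_L gamma nu)
  (hsigma0 : p_sigma2 xi0 = sigma2_L Sigma nu)
  (X : R -> Omega -> 'cV[R]_d)
  (hX : graph_supOU P e c gamma Sigma nu (p_alpha xi0) (p_beta xi0) X)
  (hX2 : forall t i, (\int[P]_w (X t w i 0 ^+ 2)%:E < +oo)%E)
  (Delta : R) (hDelta : 0 < Delta) (m : nat) (hm : (2 <= m)%N)
  (V : nat -> Omega -> 'M[R]_(gmm_dim d m))
  (hV_meas : forall N, rmx_measurable (V N))
  (hV_pos : forall N, (m < N)%N -> {ae P, forall w, posdefmx (V N w)})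
  (xihat : nat -> Omega -> gpar R d)
  (hxihat_meas : forall N, gpar_measurable (xihat N))
  (hxihat : forall N, (m < N)%N -> {ae P, forall w,
     W (xihat N w) /\
     forall xi, W xi ->
       dot (gmm_g m (Kmx e c) Delta X N w (xihat N w))
           (V N w *m gmm_g m (Kmx e c) Delta X N w (xihat N w)) <=
       dot (gmm_g m (Kmx e c) Delta X N w xi)
           (V N w *m gmm_g m (Kmx e c) Delta X N w xi)})
  (h1_int : forall xi, W xi -> forall t, (0 < t)%N -> forall i,
     P.-integrable setT (fun w =>
       ((gmm_f (Kmx e c) Delta (obs_window Delta X t w) xi
           : 'cV[R]_(gmm_dim d m)) i 0)%:E))
  (h1_id : forall xi, W xi ->
     ((forall t, (0 < t)%N -> gmm_Ef P m (Kmx e c) Delta X t xi = 0)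
      <-> xi = xi0))
  (h2 : forall t, (0 < t)%N -> forall i (eps : R), 0 < eps ->
     P [set w | (eps%:E <= ereal_sup
          [set `|gmm_g m (Kmx e c) Delta X N w xi i 0
                 - gmm_Ef P m (Kmx e c) Delta X t xi i 0|%:E | xi in W])%E]
       @[N --> \oo] --> 0%E)
  (Vbar : nat -> 'M[R]_(gmm_dim d m))
  (hVbar_pos : forall N, (m < N)%N -> posdefmx (Vbar N))
  (* the sequence is uniformly, not just termwise, positive definite *)
  (hVbar_unif : exists lo hi : R, 0 < lo /\
     forall N, (m < N)%N -> forall u : 'cV[R]_(gmm_dim d m),
       lo * dot u u <= dot u (Vbar N *m u) <= hi * dot u u)
  (h3 : cvg_prob P (fun N w => V N w - Vbar N) (fun _ => 0)) :
  forall eps : R, 0 < eps ->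
    P [set w | eps <= gpar_dist (xihat N w) xi0] @[N --> \oo] --> 0%E.
Proof.
have [G [lam [Gu lam0 KE GG]]] := Kmx_diagonalize he_sym he_irr hc.
have dom0 : gpar_dom xi0 by exact: hW.
have Ef0 : forall t, (0 < t)%N -> gmm_Ef P m (Kmx e c) Delta X t xi0 = 0.
  exact: (h1_id _ hxi0).2.
have int0 : forall t, (0 < t)%N -> gmm_integrable P m (Kmx e c) Delta X t xi0.
  by move=> t t0; exact: h1_int.
have EfB xi t : (0 < t)%N -> gmm_Ef P m (Kmx e c) Delta X t xi =
    gmm_moments m (Kmx e c) Delta xi0 - gmm_moments m (Kmx e c) Delta xi.
  by move=> t0; rewrite (gmm_EfB _ (int0 _ t0)) Ef0 // add0r.
move=> eps eps0.
have mdist N : measurable [set w | eps <= gpar_dist (xihat N w) xi0].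
  by apply: measurable_le_set; exact: measurable_gpar_dist.
have [s0|s0] := eqVneq (p_sigma2 xi0) 0.
  (* Degenerate case: the event is almost surely empty for N > m. *)
  apply: (@vanishing_ae_sub _ _ _ P (fun=> set0) _ _ _).2; last first.
    by split; [near=> N | under eq_fun do rewrite measure0; exact: cvg_cst].
  near=> N; have mN : (m < N)%N by near: N; exact: nbhs_infty_gt.
  split=> //; have Z0 := gmm_g_degenerate N s0 int0 Ef0.
  apply: filterS (filterI (filterI Z0 (hV_pos _ mN)) (hxihat _ mN)).
  move=> w [[/= Z0w [_ Vpos]] [Wh hmin]].
  have := hmin _ hxi0; rewrite Z0w.
  rewrite mulmx0 [leRHS](_ : _ = 0); last by rewrite /dot mulmx0 mxE.
  set g := gmm_g _ _ _ _ _ _ _ => g_le0.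
  have g0 : g = 0.
    by apply/eqP; apply: contraTT g_le0 => /Vpos; rewrite ltNge.
  have M0 : gmm_moments m (Kmx e c) Delta xi0 - gmm_moments m (Kmx e c) Delta (xihat N w) = 0.
    by have := gmm_gB (Kmx e c) Delta X w (xihat N w) xi0 mN; rewrite -/g g0 Z0w add0r.
  (* With zero covariance the lags carry no information on alpha and beta, so identification comes
     from assumption (1): equal moments make every expectation at [xihat N w] vanish. *)
  have -> : xihat N w = xi0.
    by apply: (h1_id _ Wh).1 => t t0; rewrite EfB.
  by rewrite gpar_dist_self leNgt eps0.
have [lo [hi [lo0 hVb]]] := hVbar_unif.
have [del del0 hdel] := moments_identify Gu lam0 GG KE hDelta hm dom0 s0 eps0.
pose n := gmm_dim d m.
(* The factor n passes from the componentwise bound on g_N(xi0) to its squared norm; the other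
   factor is that of [argmin_dot_le]. *)
pose C := n%:R * (2 * `|hi| / lo + 1).
have C0 : 0 <= C.
  by rewrite mulr_ge0 // addr_ge0 // divr_ge0 ?(ltW lo0) // mulr_ge0.
(* Half of [del] is reserved for g_N(xi0) and half for g_N(xihat). *)
have [eta [eta0 etad Ceta]] := exists_small_sqr (divr_gt0 del0 (ltr0Sn R 1)) C0.
pose Z N w := gmm_g m (Kmx e c) Delta X N w xi0.
pose A1 (i : 'I_n) N := [set w | eta <= `|Z N w i 0|].
pose A2 N := [set w | lo / 2 / n.+1%:R <= enorm (V N w - Vbar N - 0)].
have v1 i : vanishing P (A1 i).
  split.
    near=> N; apply: measurable_le_set.
    have mZ := measurable_gmm_g N i int0.
    exact: (measurableT_comp (@normr_measurable R setT) mZ).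
  apply: cvg_trans (h2 1%N isT i eta eta0); apply: near_eq_cvg.
  near=> N; have mN : (m < N)%N by near: N; exact: nbhs_infty_gt.
  (* By the splitting of f the difference is the same for every [xi], so the supremum is over a
     singleton; [xi0] in [W] makes the set nonempty. *)
  have supE w : [set `|gmm_g m (Kmx e c) Delta X N w xi i 0 -
      gmm_Ef P m (Kmx e c) Delta X 1 xi i 0|%:E | xi in W] = [set `|Z N w i 0|%:E].
    have ZE xi : gmm_g m (Kmx e c) Delta X N w xi i 0 -
        gmm_Ef P m (Kmx e c) Delta X 1 xi i 0 = Z N w i 0.
      by rewrite (gmm_gB _ _ _ _ xi xi0 mN) EfB // mxE addrK.
    apply/seteqP; split => [_ [xi _ <-]|_ ->] /=; first by rewrite ZE.
    by exists xi0 => //; rewrite ZE.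
  congr (P _); apply/seteqP; split => w /=; rewrite supE ereal_sup1 lee_fin //.
have v2 : vanishing P A2.
  split; last by apply: h3; rewrite !divr_gt0.
  near=> N; apply: measurable_le_set.
  under eq_fun do rewrite subr0.
  by apply: measurable_enorm; exact: hV_meas.
(* Off both exceptional families minimality bounds g_N(xihat), so the moments at the estimator are
   within [del] of the true ones. *)
have := vanishingU (vanishing_bigU (index_enum 'I_n) v1) v2.
move=> /vanishing_ae_sub h; apply: (h _ _).2 => {h}.
near=> N; have mN : (m < N)%N by near: N; exact: nbhs_infty_gt.
split=> //; apply: filterS (hxihat _ mN) => w [Wh hmin] /= dw.
apply: contrapT => /not_orP [nA1 nA2].
have Zeta i : `|Z N w i 0| < eta.
  rewrite ltNge; apply/negP => h; apply: nA1.
  by rewrite -bigcup_seq; exists i => //=; rewrite mem_index_enum.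
move: nA2; rewrite /A2 /= subr0 => /negP; rewrite -ltNge => hV.
move: dw; rewrite leNgt => /negP; apply; apply: hdel; first exact: hW.
move=> i.
set g := gmm_g m (Kmx e c) Delta X N w (xihat N w).
have := argmin_dot_le lo0 (hVb N mN) hV (hmin _ hxi0); rewrite -/g -/(Z N w) => gZ.
have ZZ : dot (Z N w) (Z N w) <= n%:R * eta ^+ 2.
  rewrite dot_self -[n in n%:R]card_ord mulr_natl -sumr_const ler_sum // => j _.
  by rewrite -[leLHS]real_normK ?num_real // ler_sqr ?nnegrE ?(ltW eta0) ?(ltW (Zeta j)).
have gi : `|g i 0| < del / 2.
  rewrite -ltr_sqr ?nnegrE ?normr_ge0 ?divr_ge0 ?ltW // real_normK ?num_real //.
  apply: le_lt_trans Ceta; apply: (@le_trans _ _ (dot g g)).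
    by rewrite dot_self (bigD1 i) //= lerDl sumr_ge0 // => j _; rewrite sqr_ge0.
  apply: le_trans gZ _; rewrite /C -[leRHS]mulrA [leRHS]mulrCA ler_wpM2l //.
  by rewrite addr_ge0 // divr_ge0 ?(ltW lo0) // mulr_ge0.
have -> : gmm_moments m (Kmx e c) Delta (xihat N w) i 0 - gmm_moments m (Kmx e c) Delta xi0 i 0
    = Z N w i 0 - g i 0.
  rewrite /g (gmm_gB _ _ _ _ (xihat N w) xi0 mN) -/(Z N w) !mxE; ring.
apply: le_lt_trans (ler_normB _ _) _.
apply: lt_le_trans (ltrD (Zeta i) gi) _.
by rewrite [leRHS](splitr del) lerD2r.
Unshelve. all: by end_near.
Qed.
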